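(* Let $D$ be a countably infinite solid tournament. Then $D$ has a Hamilton path, i.e. there is an injective topological path $\alpha\colon[0,1]\to|D|$ that traverses every vertex of $D$. Moreover, for every vertex $r\in V(D)$ that can reach every other vertex of $D$, there is a Hamilton path $\alpha$ in $|D|$ that starts at $r$, i.e. with $\alpha(0)=r$.
   Context: Digraphs. A tournament is a digraph without loops in which any two distinct vertices are joined by exactly one directed edge. All paths in digraphs are directed; a vertex $v$ can reach $w$ in $D$ if there is a finite directed path from $v$ to $w$. A strong component is a maximal strongly connected subdigraph. $D$ is solid if $D-X$ has only finitely many strong components for every finite $X\subseteq V(D)$. Ends. A ray is a one-way infinite directed path that has a first vertex but no last vertex; its subrays are its tails. A ray in $D$ is solid in $D$ if for every finite $X\subseteq V(D)$ it has a tail in some strong component of $D-X$. Two solid rays are equivalent if for every finite $X\subseteq V(D)$ they have a tail in the same strong component of $D-X$. The equivalence classes are the ends of $D$; a ray in a class represents that end. $\Omega(D)$ is the set of ends. For an end $\omega$ and a finite $X\subseteq V(D)$, $C(X,\omega)$ is the strong component of $D-X$ in which every ray representing $\omega$ has a tail, and $\Omega(X,\omega)$ is the set of ends represented by a ray in $C(X,\omega)$. A finite $X$ separates ends $\omega,\eta$ if $C(X,\omega)\neq C(X,\eta)$. Limit edges. For distinct ends $\omega,\eta$, the pair $(\omega,\eta)$ is a limit edge from $\omega$ to $\eta$ if $D$ has an edge from $C(X,\omega)$ to $C(X,\eta)$ for every finite $X\subseteq V(D)$ separating $\omega$ and $\eta$. For a vertex $v$ and an end $\omega$, $(v,\omega)$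 is a limit edge from $v$ to $\omega$ if $D$ has an edge from $v$ to $C(X,\omega)$ for every finite $X\subseteq V(D)$ with $v\notin C(X,\omega)$; and $(\omega,v)$ is a limit edge from $\omega$ to $v$ if $D$ has an edge from $C(X,\omega)$ to $v$ for every finite $X\subseteq V(D)$ with $v\notin C(X,\omega)$. $\Lambda(D)$ is the set of limit edges. The space $|D|$. Its ground set is obtained from $V(D)\cup\Omega(D)$ and a copy $[0,1]_e$ of the unit interval for each $e\in E(D)\cup\Lambda(D)$ by identifying the tail of $e$ with $0\in[0,1]_e$ and the head of $e$ with $1\in[0,1]_e$. The topology is generated by the following basic open sets. (1) For a vertex $v$: for $\varepsilon>0$, the uniform star of radius $\varepsilon$ around $v$, i.e. $v$ together with an (open) $\varepsilon$ length, starting at $v$, of every edge or limit edge incident with $v$. (2) For an inner point of an edge $e\in E(D)$: open subintervals of $[0,1]_e$ containing it. (3) For an end $\omega$: for finite $X\subseteq V(D)$ and $\varepsilon>0$, the set $\hat C_\varepsilon(X,\omega)$, the union of $C(X,\omega)$ (with its edges), $\Omega(X,\omega)$, every limit edge with both endpoints in $C(X,\omega)\cup\Omega(X,\omega)$, and an (open) $\varepsilon$ length, at the endpoint lying in $C(X,\omega)\cup\Omega(X,\omega)$, of every edge or limit edge with precisely one endpoint in $C(X,\omega)\cup\Omega(X,\omega)$. (4) For an inner point $z$ of a limit edge $(\omega,\eta)$ between ends: for finite $X$ separating $\omega$ and $\eta$ and $\varepsilon>0$ small, the union of the open $\varepsilon$-intervals around the copy of $z$ in every edge or limit edge from $C(X,\omega)\cup\Omega(X,\omega)$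 to $C(X,\eta)\cup\Omega(X,\eta)$. (5) For an inner point $z$ of a limit edge $(v,\omega)$ with $v$ a vertex: for finite $X$ containing $v$ and $\varepsilon>0$ small, the union of the open $\varepsilon$-intervals around the copy of $z$ in every edge or limit edge from $v$ to $C(X,\omega)\cup\Omega(X,\omega)$; analogously for limit edges $(\omega,v)$, using edges and limit edges from $C(X,\omega)\cup\Omega(X,\omega)$ to $v$. Topological paths. A topological path in $|D|$ is a continuous map $\alpha\colon[0,1]\to|D|$ that respects the direction of the edges and limit edges it traverses: whenever $s<t$ and $\alpha([s,t])\subseteq[0,1]_e$ for some $e\in E(D)\cup\Lambda(D)$, the coordinate of $\alpha(s)$ in $[0,1]_e$ is at most that of $\alpha(t)$. A Hamilton path of $D$ (or in $|D|$) is an injective topological path in $|D|$ that traverses every vertex of $D$ (exactly once). *)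

(* Defs.v *)
From HB Require Import structures.
From mathcomp Require Import all_boot all_order all_algebra.
From mathcomp Require Import all_classical all_reals all_analysis.

Set Implicit Arguments.
Unset Strict Implicit.
Unset Printing Implicit Defensive.

Import Order.TTheory GRing.Theory Num.Theory.
Import numFieldNormedType.Exports.

Local Open Scope classical_set_scope.
Local Open Scope ring_scope.

Record digraph := Digraph {
  vertex :> choiceType;
  edge : rel vertex
}.
Arguments edge : clear implicits.

Definition tournament (D : digraph) : Prop :=
  (forall v : D, ~~ edge D v v) /\
  (forall v w : D, v != w -> edge D v w (+) edge D w v).

Section Digraph.
Variable D : digraph.

(* A finite directed path from [v] to [w] in the subdigraph of [D] induced
   by [S]; the path has vertices [v :: p]. *)
Definition reach_in (S : set D) (v w : D) : Prop :=
  exists p : seq D, [/\ path (edge D) v p, uniq (v :: p), last v p = w &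
    forall u, u \in v :: p -> S u].

Definition reach (v w : D) : Prop := reach_in setT v w.

Definition strongly_connected (C : set D) : Prop :=
  C !=set0 /\ forall v w, C v -> C w -> reach_in C v w.

(* A maximal strongly connected subdigraph of [D - X] is induced, so it is
   represented by its vertex set [C]. *)
Definition strong_component (X C : set D) : Prop :=
  [/\ C `<=` ~` X, strongly_connected C &
    forall C', C `<=` C' -> C' `<=` ~` X -> strongly_connected C' -> C' = C].

Definition solid : Prop :=
  forall X : set D, finite_set X -> finite_set (strong_component X).

Definition ray (r : nat -> D) : Prop :=
  injective r /\ forall n, edge D (r n) (r n.+1).

Definition has_tail_in (r : nat -> D) (C : set D) : Prop :=
  exists n, forall m, (n <= m)%N -> C (r m).

Definition solid_ray (r : nat -> D) : Prop :=
  ray r /\ forall X : set D, finite_set X ->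
    exists2 C, strong_component X C & has_tail_in r C.

Definition ray_equiv (r s : nat -> D) : Prop :=
  forall X : set D, finite_set X ->
    exists C, [/\ strong_component X C, has_tail_in r C & has_tail_in s C].

Record dend := DEnd {
  end_rays : set (nat -> D);
  end_raysP : exists2 r, solid_ray r &
    end_rays = [set s | solid_ray s /\ ray_equiv r s]
}.

(* $C(X,\omega)$. For finite [X] exactly one strong component of [D - X]
   satisfies the condition, so the union is that component. *)
Definition end_comp (X : set D) (w : dend) : set D :=
  \bigcup_(C in [set C | strong_component X C /\
                         forall r, end_rays w r -> has_tail_in r C]) C.

(* $\Omega(X,\omega)$ *)
Definition end_ends (X : set D) (w : dend) : set dend :=
  [set h : dend | exists2 r, end_rays h r & forall n, end_comp X w (r n)].

Definition separates (X : set D) (w h : dend) : Prop :=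
  end_comp X w <> end_comp X h.

Definition edge_between (A B : set D) : Prop :=
  exists a b, [/\ A a, B b & edge D a b].

Definition node : Type := (D + dend)%type.

Definition limit_edge (x y : node) : Prop :=
  match x, y with
  | inr w, inr h => w <> h /\
      forall X : set D, finite_set X -> separates X w h ->
        edge_between (end_comp X w) (end_comp X h)
  | inl v, inr w =>
      forall X : set D, finite_set X -> ~ end_comp X w v ->
        edge_between [set v] (end_comp X w)
  | inr w, inl v =>
      forall X : set D, finite_set X -> ~ end_comp X w v ->
        edge_between (end_comp X w) [set v]
  | inl _, inl _ => False
  end.

Definition is_edge (x y : node) : Prop :=
  match x, y with
  | inl v, inl w => edge D v w
  | _, _ => False
  end.

(* The elements of $E(D)\cup\Lambda(D)$. *)
Record arrow := Arrow {
  src : node;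
  tgt : node;
  arrowP : is_edge src tgt \/ limit_edge src tgt
}.

(* $C(X,\omega)\cup\Omega(X,\omega)$ *)
Definition end_nodes (X : set D) (w : dend) : set node :=
  inl @` end_comp X w `|` inr @` end_ends X w.

End Digraph.

(* The ground set of $|D|$: every class of the identification contains either
   exactly one vertex or end, or a single inner point of a single
   $[0,1]_e$. *)
Inductive dspace (R : realType) (D : digraph) : Type :=
| Node of node D
| Inner of arrow D & {t : R | 0 < t < 1}.
Arguments Node {R D} _.
Arguments Inner {R D} _ _.

Section Space.
Variables (R : realType) (D : digraph).
Local Notation space := (dspace R D).

(* The quotient map on $[0,1]_e$; only used for [t] in [0, 1]. *)
Definition arrow_point (e : arrow D) (t : R) : space :=
  if (insub t : {? x : R | 0 < x < 1}) is Some u then Inner e u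
  else if t <= 0 then Node (src e) else Node (tgt e).

Definition arrow_itv (e : arrow D) : set space := arrow_point e @` `[0, 1].

(* Only inner points of incident edges are added to [v], so any [eps >= 1]
   yields the same star as [eps = 1]. *)
Definition uniform_star (v : D) (eps : R) : set space :=
  [set p | match p with
    | Node x => x = inl v
    | Inner e t => (src e = inl v /\ val t < eps) \/
                   (tgt e = inl v /\ 1 - eps < val t)
    end].

Definition inner_itv (e : arrow D) (a b : R) : set space :=
  [set p | exists2 t : {t : R | 0 < t < 1}, a < val t < b & p = Inner e t].

(* $\hat C_\varepsilon(X,\omega)$; an edge of $D$ with both endpoints in
   [end_nodes X w] has both endpoints in $C(X,\omega)$. *)
Definition end_nbhd (X : set D) (w : dend D) (eps : R) : set space :=
  let N := end_nodes X w in
  [set p | match p with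
    | Node x => N x
    | Inner e t => [\/ N (src e) /\ N (tgt e),
                       [/\ N (src e), ~ N (tgt e) & val t < eps] |
                       [/\ ~ N (src e), N (tgt e) & 1 - eps < val t]]
    end].

Definition tube (A B : set (node D)) (z eps : R) : set space :=
  \bigcup_(e in [set e | A (src e) /\ B (tgt e)])
    inner_itv e (z - eps) (z + eps).

(* In the last three cases, "[eps] small" means that the open [eps]-interval
   around [z] lies in the open unit interval. *)
Inductive basic_open : set (set space) :=
| basic_vertex (v : D) (eps : R) :
    0 < eps -> basic_open (uniform_star v eps)
| basic_edge (e : arrow D) (a b : R) :
    is_edge (src e) (tgt e) -> 0 <= a -> a < b -> b <= 1 ->
    basic_open (inner_itv e a b)
| basic_end (X : set D) (w : dend D) (eps : R) :
    finite_set X -> 0 < eps -> basic_open (end_nbhd X w eps)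
| basic_limit_end_end (X : set D) (w h : dend D) (z eps : R) :
    limit_edge (inr w) (inr h) -> finite_set X -> separates X w h ->
    0 < z < 1 -> 0 < eps -> 0 <= z - eps -> z + eps <= 1 ->
    basic_open (tube (end_nodes X w) (end_nodes X h) z eps)
| basic_limit_vertex_end (X : set D) (v : D) (w : dend D) (z eps : R) :
    limit_edge (inl v) (inr w) -> finite_set X -> X v ->
    0 < z < 1 -> 0 < eps -> 0 <= z - eps -> z + eps <= 1 ->
    basic_open (tube [set inl v] (end_nodes X w) z eps)
| basic_limit_end_vertex (X : set D) (v : D) (w : dend D) (z eps : R) :
    limit_edge (inr w) (inl v) -> finite_set X -> X v ->
    0 < z < 1 -> 0 < eps -> 0 <= z - eps -> z + eps <= 1 ->
    basic_open (tube (end_nodes X w) [set inl v] z eps).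

HB.instance Definition _ := gen_eqMixin space.
HB.instance Definition _ := gen_choiceMixin space.
HB.instance Definition _ :=
  isSubBaseTopological.Build space basic_open id.

(* Paths are functions on [R] of which only the restriction to [0, 1]
   matters. *)
Definition topological_path (f : R -> space) : Prop :=
  {within `[0, 1], continuous f} /\
  forall (s t : R) (e : arrow D), 0 <= s -> s < t -> t <= 1 ->
    f @` `[s, t] `<=` arrow_itv e ->
    forall x y : R, 0 <= x <= 1 -> 0 <= y <= 1 ->
      f s = arrow_point e x -> f t = arrow_point e y -> x <= y.

Definition hamilton_path (f : R -> space) : Prop :=
  [/\ topological_path f, set_inj `[0, 1] f &
    forall v : D, exists2 t, 0 <= t <= 1 & f t = Node (inl v)].

End Space.

(* Main.v *)
From mathcomp Require Import all_boot all_order all_algebra.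
From mathcomp Require Import all_classical all_reals all_analysis.
From mathcomp Require Import lra zify.
Require Import Defs.

Set Implicit Arguments.
Unset Strict Implicit.
Unset Printing Implicit Defensive.

Import Order.TTheory GRing.Theory Num.Theory.
Import numFieldNormedType.Exports.

Local Open Scope classical_set_scope.
Local Open Scope ring_scope.

(** In an induced subdigraph of a tournament, all edges between two distinct
    strong components point in the same direction, and so the components are
    linearly ordered. In a solid tournament there are finitely many of them
    after the deletion of a finite set, hence they form a list in which each
    component dominates all later ones ([sorted_components_ex]).

    Let [r] reach every vertex. The order of the path is found by refining the
    trivial partition of the vertex set. Each part has an entrance, a vertex
    that reaches the whole part inside the part; at first this is [r]. One
    step takes the entrance [e] out of each part [C] and lets [e] be followed
    by the strong components of [C - e] in their order. Since [e] reaches all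
    of [C], it has an out-neighbour in the first of these components, and such
    an out-neighbour becomes the entrance there. The other components may be
    given any entrance, because they are dominated by what precedes them.
    Thus in the order of the parts, every vertex of a part has an edge to the
    entrance of the next part, and this survives refinement
    ([consecutive_edge]). If entrances are chosen so as to approach the vertex
    of least index in the part, then every vertex is taken out at some step
    ([eventually_removed]).

    The parts are assigned consecutive intervals of time. Those of the parts
    that are not yet single vertices shrink to zero. In the limit a vertex [v]
    owns a half-open interval from [depart v] to [arrive v], and a time outside
    all of these belongs to a decreasing sequence of parts, which are strong
    components of [D - X] for finite sets [X] that exhaust the vertices; such a
    sequence determines an end ([node_at_ex]). The point reached at time
    [depart v] is a vertex with an edge to [v], or an end for which all
    sufficiently late parts dominate [v]; in the second case there is a
    limit edge from that end to [v] ([arrow_into]). The path traverses this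
    edge or limit edge during the interval of [v].

    A part starts with its entrance, so an end is never entered by a limit
    edge but is a limit of vertices. A neighbourhood of the end contains
    one of its parts, and after the entrance of that part has been passed, the
    path remains inside until the interval of the part is over
    ([hpath_end_nbhd]). This gives continuity at ends, the other points being
    handled by the continuity of the single edges.

    A root [r] always exists: any vertex of the first strong component of [D]
    ([exists_root]). *)

(** * Reachability and strong components *)

Section Reachability.
Variable D : digraph.
Implicit Types (S X C : set D) (u v w x : D).

Definition walk S (k : nat) u v : Prop := exists p : seq D,
  [/\ path (edge D) u p, last u p = v, forall x, x \in u :: p -> S x &
      (size p <= k)%N].

Lemma walk_reach S k u v : walk S k u v -> reach_in S u v.
Proof.
move=> [p [pp <- pS _]].
case: (shortenP pp) => p' pp' up' sp'.
exists p'; split=> // x xp; apply: pS.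
by move: xp; rewrite !inE => /orP[->//|/sp' ->]; rewrite orbT.
Qed.

Lemma reach_walk S u v : reach_in S u v -> exists k, walk S k u v.
Proof. by move=> [p [pp up lp pS]]; exists (size p), p; split. Qed.

Lemma walk_le S k l u v : (k <= l)%N -> walk S k u v -> walk S l u v.
Proof. by move=> kl [p [? ? ? pk]]; exists p; split=> //; apply: leq_trans kl. Qed.

Lemma walk_cat S k l u v w :
  walk S k u v -> walk S l v w -> walk S (k + l) u w.
Proof.
move=> [p [pp lp pS pk]] [q [qq lq qS ql]]; exists (p ++ q); split.
- by rewrite cat_path pp lp.
- by rewrite last_cat lp.
- move=> x; rewrite -cat_cons mem_cat => /orP[/pS//|xq].
  by apply: qS; rewrite inE xq orbT.
- by rewrite size_cat leq_add.
Qed.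

Lemma reach_in_refl S u : S u -> reach_in S u u.
Proof. by move=> Su; exists [::]; split=> // x; rewrite inE => /eqP->. Qed.

Lemma reach_in_trans S u v w : reach_in S u v -> reach_in S v w -> reach_in S u w.
Proof.
move=> /reach_walk[k uv] /reach_walk[l vw].
exact: walk_reach (walk_cat uv vw).
Qed.

Lemma reach_in_sub S S' u v : S `<=` S' -> reach_in S u v -> reach_in S' u v.
Proof. by move=> SS' [p [? ? ? pS]]; exists p; split=> // x /pS/SS'. Qed.

Lemma reach_in_edge S u v : S u -> S v -> edge D u v -> reach_in S u v.
Proof.
move=> Su Sv uv; apply: (@walk_reach _ 1); exists [:: v]; split=> //=.
  by rewrite uv.
by move=> x; rewrite !inE => /orP[]/eqP->.
Qed.

Lemma reach_in_mem S u v : reach_in S u v -> S u /\ S v.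
Proof.
move=> [p [_ _ <- pS]]; split; first by apply: pS; rewrite inE eqxx.
by apply: pS; rewrite mem_last.
Qed.

Definition scomp S v : set D := [set u | reach_in S v u /\ reach_in S u v].

Lemma scomp_refl S v : S v -> scomp S v v.
Proof. by move=> Sv; split; apply: reach_in_refl. Qed.

Lemma scomp_sub S v : scomp S v `<=` S.
Proof. by move=> u [vu _]; case: (reach_in_mem vu). Qed.

Lemma scompS S S' v : S `<=` S' -> scomp S v `<=` scomp S' v.
Proof. by move=> SS' u [vu uv]; split; apply: reach_in_sub SS' _. Qed.

Lemma scomp_sym S u v : scomp S v u -> scomp S u v.
Proof. by case. Qed.

Lemma scomp_eq S u v : scomp S v u -> scomp S u = scomp S v.
Proof.
move=> [vu uv]; apply/seteqP; split=> w [];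
  by split; [apply: reach_in_trans; eassumption..].
Qed.

(** Every vertex of the walk lies on a closed walk through its endpoints. *)
Lemma walk_scomp S k u v : reach_in S v u -> walk S k u v -> walk (scomp S u) k u v.
Proof.
move=> vu [p [pp lp pS pk]]; exists p; split=> // z zp.
suff [uz zv] : reach_in S u z /\ reach_in S z v.
  by split=> //; apply: reach_in_trans zv vu.
move: zp; rewrite inE => /orP[/eqP->|zp].
  split; last by apply: (@walk_reach _ k); exists p.
  by apply: reach_in_refl; apply: pS; rewrite inE eqxx.
move: pp lp pS {pk}; case/splitPr: zp => p1 p2.
rewrite cat_path last_cat /= => /and3P[pp1 l1 pp2] lp pS; split.
  apply: (@walk_reach _ (size p1).+1); exists (rcons p1 z).
  rewrite rcons_path pp1 last_rcons size_rcons; split=> // w.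
  rewrite inE mem_rcons => wz; apply: pS; move: wz.
  by rewrite !inE mem_cat inE => /or3P[]->; rewrite ?orbT.
apply: (@walk_reach _ (size p2)); exists p2; split=> // w.
rewrite inE => wz; apply: pS; move: wz.
by rewrite !inE mem_cat inE => /orP[]->; rewrite ?orbT.
Qed.

Lemma scomp_strong S v : S v -> strongly_connected (scomp S v).
Proof.
move=> Sv; split; first by exists v; apply: scomp_refl.
move=> x y vx vy; have xy : scomp S x y by rewrite (scomp_eq vx).
have [k /(walk_scomp xy.2)] := reach_walk xy.1.
by rewrite (scomp_eq vx); apply: walk_reach.
Qed.

(** Once loops are cut out, the rest of the walk avoids its first vertex. *)
Lemma walk_tail S k u v : walk S k u v -> u <> v ->
  exists2 w, edge D u w & walk (S `\ u) k.-1 w v.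
Proof.
move=> [p [pp <- pS pk]]; case: (shortenP pp) => -[|w q] //= /andP[uw wq].
move=> /andP[uq uwq] sq _; exists w => //; exists q; split=> //.
  move=> x xq; split; last by move=> xu; rewrite -xu xq in uq.
  by apply: pS; rewrite inE sq ?orbT.
have -> : size q = (size (w :: q)).-1 by [].
rewrite -!subn1 leq_sub2r // (leq_trans _ pk) //.
by apply: (@uniq_leq_size _ (w :: q)) => // x; apply: sq.
Qed.

Lemma strong_sub_scomp S A v :
  A `<=` S -> strongly_connected A -> A v -> A `<=` scomp S v.
Proof. by move=> AS [_ Ast] Av u Au; split; apply: reach_in_sub AS (Ast _ _ _ _). Qed.

Lemma strong_component_scomp X v : ~ X v -> strong_component X (scomp (~` X) v).
Proof.
move=> Xv; split; [exact: scomp_sub|exact: scomp_strong|].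
move=> C' sC' C'X C'st; apply/seteqP; split=> //.
by apply: strong_sub_scomp => //; apply: sC'; apply: scomp_refl.
Qed.

Lemma strong_componentE X C v : strong_component X C -> C v -> C = scomp (~` X) v.
Proof.
move=> [CX Cst Cmax] Cv; apply/esym/Cmax.
- exact: strong_sub_scomp.
- exact: scomp_sub.
- by apply: scomp_strong; apply: CX.
Qed.

Lemma strong_component_eq X C C' v :
  strong_component X C -> strong_component X C' -> C v -> C' v -> C = C'.
Proof.
by move=> CX CX' Cv Cv'; rewrite (strong_componentE CX Cv) (strong_componentE CX' Cv').
Qed.

Lemma strong_component_absorb X C A v :
  strong_component X C -> A `<=` ~` X -> strongly_connected A -> A v -> C v ->
  A `<=` C.
Proof.
by move=> CX AX Ast Av Cv; rewrite (strong_componentE CX Cv); exact: strong_sub_scomp.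
Qed.

End Reachability.

(** * The order of the strong components of a tournament *)

Section Tournament.
Variables (D : digraph) (tournament_D : tournament D).
Implicit Types (S X C : set D) (u v w x : D).

Lemma tournament_total u v : u <> v -> edge D u v \/ edge D v u.
Proof.
move=> /eqP uv; case: tournament_D => _ /(_ _ _ uv).
by case: (edge D u v); [left|case: (edge D v u) => //; right].
Qed.

(** Two opposite edges between the components would merge them. *)
Lemma scomp_dominates S u v u' v' : S u -> S v -> ~ scomp S u v -> edge D u v ->
  scomp S u u' -> scomp S v v' -> edge D u' v'.
Proof.
move=> Su Sv nuv uv uu' vv'.
have Suv : reach_in S u v by apply: reach_in_edge.
have [|//|vu] := @tournament_total u' v'.
  move=> e; apply: nuv; rewrite -(scomp_eq uu') e (scomp_eq vv').
  exact: scomp_refl.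
exfalso; apply: nuv; split=> //.
apply: (reach_in_trans vv'.1); apply: (reach_in_trans _ uu'.2).
by apply: reach_in_edge vu; [exact: scomp_sub vv'|exact: scomp_sub uu'].
Qed.

Definition dominates (A B : set D) : Prop :=
  forall a b, A a -> B b -> edge D a b.

Definition sorted_components S (s : seq (set D)) : Prop :=
  [/\ uniq s, forall C, C \in s <-> strong_component (~` S) C &
      forall i j, (i < j < size s)%N -> dominates (nth set0 s i) (nth set0 s j)].

(** Domination is a total order on the components: a component [C] with
    [A -> B -> C -> A] would be the same as [A]. *)
Lemma sorted_components_ex S : finite_set (strong_component (~` S)) ->
  exists s, sorted_components S s.
Proof.
move=> /finite_seqP[s0 s0E].
pose s1 := undup s0.
have s1E C : C \in s1 <-> strong_component (~` S) C.
  by rewrite mem_undup s0E.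
pose le (A B : set D) := (A == B) || `[< dominates A B >].
pose P := [pred C : set D | C \in s1].
have PS C : P C -> exists2 v, S v & C = scomp S v.
  move=> /s1E Cc; have [Cs [[v Cv] _] _] := Cc.
  exists v; first by have := Cs _ Cv; rewrite setCK.
  by rewrite (strong_componentE Cc Cv) setCK.
have tot : {in P &, total le}.
  move=> _ _ /PS[u Su ->] /PS[v Sv ->]; rewrite /le.
  have [uv|nuv] := pselect (scomp S u v).
    by rewrite (scomp_eq uv) eqxx.
  have nvu : ~ scomp S v u by move=> /scomp_sym.
  have [e|uv|vu] := @tournament_total u v.
  - by apply: nuv; rewrite e; apply: scomp_refl.
  - have -> : `[< dominates (scomp S u) (scomp S v) >] by
      apply/asboolP => a b; apply: scomp_dominates.
    by rewrite orbT.
  - have -> : `[< dominates (scomp S v) (scomp S u) >] by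
      apply/asboolP => a b; apply: scomp_dominates.
    by rewrite !orbT.
have tr : {in P & &, transitive le}.
  move=> _ _ _ /PS[v Sv ->] /PS[u Su ->] /PS[w Sw ->]; rewrite /le.
  move=> /orP[/eqP->//|/asboolP uv] /orP[/eqP<-|/asboolP vw].
    by apply/orP; right; apply/asboolP.
  have [uw|nuw] := pselect (scomp S u w); first by rewrite (scomp_eq uw) eqxx.
  have [e|uw|wu] := @tournament_total u w.
  - by case: nuw; rewrite e; apply: scomp_refl.
  - by apply/orP; right; apply/asboolP => a b; apply: scomp_dominates.
  - exfalso; apply: nuw; split; last exact: reach_in_edge.
    apply: (@reach_in_trans _ _ _ v); apply: reach_in_edge => //.
      by apply: uv; apply: scomp_refl.
    by apply: vw; apply: scomp_refl.
exists (sort le s1); split.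
- by rewrite sort_uniq undup_uniq.
- by move=> C; rewrite mem_sort.
have Ps : all P s1 by apply/allP.
have := sort_sorted_in tot Ps.
rewrite (sorted_pairwise_in tr) ?all_sort // => /(pairwiseP set0) pw i j /andP[ij js].
have is_ : (i < size (sort le s1))%N by apply: ltn_trans ij js.
have /orP[/eqP e|/asboolP //] := pw i j is_ js ij.
have : (nth set0 (sort le s1) i == nth set0 (sort le s1) j) by rewrite e.
by rewrite nth_uniq ?sort_uniq ?undup_uniq // => /eqP eij; rewrite eij ltnn in ij.
Qed.

Definition components S : seq (set D) := xget [::] (sorted_components S).
Definition ncomp S : nat := size (components S).
Definition crank S v : nat := index (scomp S v) (components S).

Section Ranks.
Variables (S : set D) (fin_S : finite_set (strong_component (~` S))).

Let cP : sorted_components S (components S).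
Proof. exact: xgetPex (sorted_components_ex fin_S). Qed.

Lemma scomp_in_components v : S v -> scomp S v \in components S.
Proof.
move=> Sv; case: cP => _ inC _; apply/inC.
by have := @strong_component_scomp D (~` S) v; rewrite setCK; apply.
Qed.

Lemma crank_lt v : S v -> (crank S v < ncomp S)%N.
Proof. by move=> Sv; rewrite index_mem scomp_in_components. Qed.

Lemma crank_inj u v : S u -> S v -> crank S u = crank S v -> scomp S u = scomp S v.
Proof.
move=> Su Sv e; rewrite -(nth_index set0 (scomp_in_components Su)).
by rewrite -(nth_index set0 (scomp_in_components Sv)) -/(crank _ _) e.
Qed.

Lemma crank_scomp u v : scomp S v u -> crank S u = crank S v.
Proof. by move=> /scomp_eq e; rewrite /crank e. Qed.

Lemma crank_dominates u v u' v' : S u -> S v -> (crank S u < crank S v)%N ->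
  scomp S u u' -> scomp S v v' -> edge D u' v'.
Proof.
move=> Su Sv uv uu' vv'; case: cP => _ _ /(_ (crank S u) (crank S v)).
rewrite uv crank_lt // => /(_ isT); rewrite !nth_index ?scomp_in_components //.
exact.
Qed.

Lemma crank_surj i : (i < ncomp S)%N -> exists2 v, S v & crank S v = i.
Proof.
move=> i_lt; case: cP => us inC _.
have /inC Cc := mem_nth set0 i_lt.
have [Cs [[v Cv] _] _] := Cc.
exists v; first by have := Cs _ Cv; rewrite setCK.
by rewrite /crank -[in scomp S v](setCK S) -(strong_componentE Cc Cv) index_uniq.
Qed.

(** Otherwise the edge back from [v] to [u] would make the two components
    equal. *)
Lemma reach_crank u v : reach_in S u v -> (crank S u <= crank S v)%N.
Proof.
move=> uv; have [Su Sv] := reach_in_mem uv.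
case: leqP => // vu; have e := crank_dominates Sv Su vu (scomp_refl Sv) (scomp_refl Su).
suff /crank_scomp E : scomp S v u by rewrite E ltnn in vu.
by split=> //; apply: reach_in_edge.
Qed.

End Ranks.
End Tournament.

(** * Rays and ends *)

Section Rays.
Variables (D : digraph) (tournament_D : tournament D).
Implicit Types (X C : set D) (w : dend D) (r s : nat -> D).

(** Consecutive [e n] are joined directly or through one further vertex of
    [C n], and no vertex is repeated because those used at step [n] lie outside
    [C n.+1]. *)
Lemma ray_through (C : nat -> set D) (e : nat -> D) :
  (forall n, C n.+1 `<=` C n) -> (forall n, C n (e n)) ->
  (forall n, ~ C n.+1 (e n)) ->
  (forall n, edge D (e n) (e n.+1) \/ exists x,
     [/\ C n x, ~ C n.+1 x, edge D (e n) x & edge D x (e n.+1)]) ->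
  exists r, ray r /\ forall n, has_tail_in r (C n).
Proof.
move=> CS Ce nCe lnk.
have /choice[x xP] : forall n, exists y, ~~ edge D (e n) (e n.+1) ->
    [/\ C n y, ~ C n.+1 y, edge D (e n) y & edge D y (e n.+1)].
  move=> n; have [ee|[y yP]] := lnk n; last by exists y.
  by exists (e n); rewrite ee.
have Cle n m : (n <= m)%N -> C m `<=` C n.
  move=> /subnK <-; elim: (m - n)%N => // k IH; rewrite addSn.
  exact: subset_trans (CS _) IH.
(* The state [(n, false)] stands for [e n], the state [(n, true)] for the
   intermediate vertex [x n]. *)
pose next (q : nat * bool) :=
  if q.2 || edge D (e q.1) (e q.1.+1) then (q.1.+1, false) else (q.1, true).
pose vtx (q : nat * bool) := if q.2 then x q.1 else e q.1.
pose st k := iter k next (0%N, false).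
pose mu (q : nat * bool) := (q.1.*2 + q.2)%N.
have good k : (st k).2 -> ~~ edge D (e (st k).1) (e (st k).1.+1).
  elim: k => //= k _; rewrite /next; case: ifP => //= /negbT.
  by rewrite negb_or => /andP[].
have vtxC k : C (st k).1 (vtx (st k)) /\ ~ C (st k).1.+1 (vtx (st k)).
  rewrite /vtx; case: ifP => [/good/xP[]//|_]; split; [exact: Ce|exact: nCe].
have muS k : (mu (st k) < mu (st k.+1))%N.
  rewrite /mu /= /next; case: (st k) => n []; case: (edge _ _ _); rewrite /= ?doubleS ?addn0 ?addn1 //.
have muk k : (k <= mu (st k))%N.
  by elim: k => // k IH; apply: leq_ltn_trans IH (muS k).
have mu_lt : {homo (fun k => mu (st k)) : i j / (i < j)%N}.
  by apply: homo_ltn muS; apply: ltn_trans.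
exists (fun k => vtx (st k)); split.
  split.
    suff H i j : (i < j)%N -> vtx (st i) <> vtx (st j).
      move=> i j ij; case: (ltngtP i j) => // /H; first by rewrite ij.
      by move=> ne; case: ne.
    move=> /mu_lt lij eij; have [_ nCi] := vtxC i; have [Cj _] := vtxC j.
    have [ij|ji] := ltnP (st i).1 (st j).1.
      by apply: nCi; rewrite eij; apply: (Cle _ _ ij).
    have := good j.
    move: lij eij {nCi Cj} ji; rewrite /vtx /mu.
    case: (st i) (st j) => n1 b1 [n2 b2] /= lij eij ji gj.
    have nE : n1 = n2 by move: lij; case: b1 b2 {eij gj} => -[]; rewrite /=; lia.
    move: lij eij gj; rewrite nE; case: b1 b2 => -[] /=; try lia.
    move=> _ eij /(_ isT)/xP[_ _ + _]; rewrite -eij.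
    by apply/negP; case: tournament_D.
  move=> k; have := good k; rewrite /= /next /vtx.
  case: (st k) => n [] /= g; first by have [] := xP _ (g isT).
  by case: (boolP (edge D (e n) (e n.+1))) => //= /xP[].
move=> n; exists (n.*2.+1) => k nk.
apply: (Cle _ _ _ _ (vtxC k).1).
by have := muk k; rewrite /mu; case: (st k).2; lia.
Qed.

Lemma has_tail_meet r C C' : has_tail_in r C -> has_tail_in r C' ->
  exists k, C (r k) /\ C' (r k).
Proof.
move=> [m mC] [n nC]; exists (maxn m n).
by split; [apply/mC/leq_maxl|apply/nC/leq_maxr].
Qed.

Lemma has_tail_shift r C m :
  has_tail_in r C -> has_tail_in (fun k => r (k + m)%N) C.
Proof. by move=> [n nC]; exists n => k nk; apply/nC/(leq_trans nk)/leq_addr. Qed.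

Lemma end_rays_solid w s : end_rays w s -> solid_ray s.
Proof. by have [r _ ->] := end_raysP w; case. Qed.

Lemma end_rays_shift w s m : end_rays w s -> end_rays w (fun k => s (k + m)%N).
Proof.
have [r rs ->] := end_raysP w; move=> [[[inj_s edge_s] sol_s] rs_eq].
split; last first.
  move=> X /rs_eq[C [Xc rC sC]].
  by exists C; split=> //; apply: has_tail_shift.
split; last by move=> X /sol_s[C Xc sC]; exists C => //; apply: has_tail_shift.
by split=> [i j /inj_s/addIn//|k]; rewrite addSn.
Qed.

Lemma solid_ray_end r : solid_ray r -> exists w, end_rays w r.
Proof.
move=> rs; have H : exists2 r', solid_ray r' &
  [set s | solid_ray s /\ ray_equiv r s] = [set s | solid_ray s /\ ray_equiv r' s].
  by exists r.
exists (DEnd H); split=> //= X /rs.2[C Xc rC].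
by exists C.
Qed.

(** The rays of an end are equivalent, so the union defining [end_comp X w] has
    exactly one member. *)
Lemma end_compP X w : finite_set X ->
  strong_component X (end_comp X w) /\
  forall s, end_rays w s -> has_tail_in s (end_comp X w).
Proof.
move=> fX; have [r rs wE] := end_raysP w.
have [C Xc rC] := rs.2 X fX.
have sC s : end_rays w s -> has_tail_in s C.
  rewrite wE => -[_ /(_ X fX)[C' [Xc' rC' sC']]].
  have [k [Ck Ck']] := has_tail_meet rC rC'.
  by rewrite (strong_component_eq Xc Xc' Ck Ck').
suff -> : end_comp X w = C by [].
apply/seteqP; split=> [v [C' [Xc' wC'] C'v]|v Cv]; last by exists C.
have wr : end_rays w r.
  by rewrite wE; split=> // Y /rs.2[K Yc rK]; exists K.
have [k [Ck Ck']] := has_tail_meet rC (wC' _ wr).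
by rewrite (strong_component_eq Xc Xc' Ck Ck').
Qed.

End Rays.

(** * Neighbourhoods in the space of a digraph *)

Section Space.
Variables (R : realType) (D : digraph).
Implicit Types (e : arrow D) (U : set (dspace R D)) (u : {t : R | 0 < t < 1}).

(** The basic sets form a subbase, so convergence may be tested on them. *)
Lemma dspace_cvg (F : set_system R) (f : R -> dspace R D) p : Filter F ->
  (forall U, basic_open U -> U p -> F (f @^-1` U)) -> f @ F --> p.
Proof.
move=> FF H A; rewrite nbhsE => -[B [oB Bp] BA].
suff : F (f @^-1` B) by apply: filterS => t /BA.
case: oB => /= I sI BE; move: Bp; rewrite -BE => -[C IC Cp].
suff : F (f @^-1` C) by apply: filterS => t Ct; exists C.
case: (sI _ IC) => J sJ CE; move: Cp; rewrite -CE => Cp.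
rewrite preimage_bigcap; apply: filter_bigI => U UJ.
by apply: H; [have := sJ _ UJ; rewrite inE|apply: Cp].
Qed.

Lemma arrow_point_inner e u : arrow_point e (val u) = Inner e u.
Proof. by rewrite /arrow_point valK. Qed.

Lemma arrow_point0 e : arrow_point e 0 = Node (src e) :> dspace R D.
Proof. by rewrite /arrow_point insubF ?ltxx // lexx. Qed.

Lemma arrow_point1 e : arrow_point e 1 = Node (tgt e) :> dspace R D.
Proof. by rewrite /arrow_point insubF ?ltxx ?andbF // ler10. Qed.

Variant unit_point_spec (t : R) : Prop :=
| UnitStart of t = 0
| UnitEnd of t = 1
| UnitInner u of t = val u.

Lemma unit_pointP (t : R) : 0 <= t <= 1 -> unit_point_spec t.
Proof.
move=> /andP[]; rewrite le_eqVlt => /orP[/eqP <- _|t0]; first exact: UnitStart.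
rewrite le_eqVlt => /orP[/eqP ->|t1]; first exact: UnitEnd.
have t01 : 0 < t < 1 by rewrite t0.
exact: (@UnitInner _ (exist _ t t01)).
Qed.

(** Basic sets of all kinds have to be considered here, since a neighbourhood of
    an end also contains vertices and inner points. *)
Lemma basic_open_src e U : basic_open U -> U (Node (src e)) ->
  exists2 d : R, 0 < d & forall u, val u < d -> U (Inner e u).
Proof.
case=> [v d d0|e' a b _ _ _ _ [//]|X w d _ d0|????? _ _ _ _ _ _ _ [? _ [//]]
  |????? _ _ _ _ _ _ _ [? _ [//]]|????? _ _ _ _ _ _ _ [? _ [//]]] /=.
- by move=> sv; exists d => // u ud; left.
- move=> Ns; exists d => // u ud.
  by have [Nt|nNt] := pselect (end_nodes X w (tgt e)); [constructor 1|constructor 2].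
Qed.

Lemma basic_open_tgt e U : basic_open U -> U (Node (tgt e)) ->
  exists2 d : R, 0 < d & forall u, 1 - d < val u -> U (Inner e u).
Proof.
case=> [v d d0|e' a b _ _ _ _ [//]|X w d _ d0|????? _ _ _ _ _ _ _ [? _ [//]]
  |????? _ _ _ _ _ _ _ [? _ [//]]|????? _ _ _ _ _ _ _ [? _ [//]]] /=.
- by move=> sv; exists d => // u ud; right.
- move=> Nt; exists d => // u ud.
  by have [Ns|nNs] := pselect (end_nodes X w (src e)); [constructor 1|constructor 3].
Qed.

Lemma basic_open_end w U : basic_open U -> U (Node (inr w)) ->
  exists X h d, [/\ finite_set X, end_nodes X h (inr w) & U = end_nbhd X h d].
Proof.
case=> [v d _|e c d _ _ _ _|X h d fX _|X w1 h z d _ _ _ _ _ _ _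
  |X v h z d _ _ _ _ _ _ _|X v h z d _ _ _ _ _ _ _];
  try by case.
- by move=> Nw; exists X, h, d.
- by case=> ? _ [].
- by case=> ? _ [].
- by case=> ? _ [].
Qed.

Lemma inner_itv_inner e e' a b u : inner_itv e' a b (Inner e u) ->
  exists2 d : R, 0 < d & forall u', `|val u' - val u| < d -> inner_itv e' a b (Inner e u').
Proof.
move=> [x /andP[ax xb] [<- ->]].
exists (Num.min (val x - a) (b - val x)); first by rewrite lt_min !subr_gt0 ax.
move=> y; rewrite lt_min !ltr_norml => /andP[/andP[y1 _] /andP[_ y2]].
by exists y => //; apply/andP; split; lra.
Qed.

Lemma tube_inner A B z r e u : tube A B z r (Inner e u) ->
  exists2 d : R, 0 < d & forall u', `|val u' - val u| < d -> tube A B z r (Inner e u').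
Proof.
move=> [e' AB /inner_itv_inner[d d0 dP]]; exists d => // y /dP ey.
by exists e'.
Qed.

Lemma basic_open_inner e U u : basic_open U -> U (Inner e u) ->
  exists2 d : R, 0 < d & forall u', `|val u' - val u| < d -> U (Inner e u').
Proof.
have low (P : Prop) (d : R) : P -> val u < d ->
    exists2 c : R, 0 < c & forall u', `|val u' - val u| < c -> P /\ val u' < d.
  move=> p ud; exists (d - val u); first by rewrite subr_gt0.
  by move=> y; rewrite ltr_norml => /andP[_]; rewrite ltrD2r.
have high (P : Prop) (d : R) : P -> 1 - d < val u ->
    exists2 c : R, 0 < c & forall u', `|val u' - val u| < c -> P /\ 1 - d < val u'.
  move=> p ud; exists (val u - (1 - d)); first by rewrite subr_gt0.
  by move=> y; rewrite ltr_norml => /andP[H _]; split=> //; lra.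
case=> [v d d0|e' a b _ _ _ _|X w d _ d0
  |X w h z d _ _ _ _ _ _ _|X v w z d _ _ _ _ _ _ _|X v w z d _ _ _ _ _ _ _] /=.
- case=> [[sv ud]|[tv ud]].
    by have [c c0 cP] := low _ _ sv ud; exists c => // y /cP; left.
  by have [c c0 cP] := high _ _ tv ud; exists c => // y /cP; right.
- exact: inner_itv_inner.
- case=> [st|[s nt ud]|[ns t ud]].
  + by exists 1 => // y _; constructor 1.
  + have [c c0 cP] := low _ _ (conj s nt) ud.
    by exists c => // y /cP[[? ?] ?]; constructor 2.
  + have [c c0 cP] := high _ _ (conj ns t) ud.
    by exists c => // y /cP[[? ?] ?]; constructor 3.
- exact: tube_inner.
- exact: tube_inner.
- exact: tube_inner.
Qed.

Lemma arrow_point_continuous e U (x : R) : basic_open U -> 0 <= x <= 1 ->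
  U (arrow_point e x) -> exists2 d : R, 0 < d &
    forall y : R, 0 <= y <= 1 -> `|y - x| < d -> U (arrow_point e y).
Proof.
move=> oU x01 Ux; case: (unit_pointP x01) => [x0|x1|u xu].
- move: (Ux); rewrite {1}x0 arrow_point0 => /(basic_open_src oU)[d d0 dP].
  exists (Num.min d 1); first by rewrite lt_min d0 ltr01.
  move=> y y01; rewrite x0 subr0 lt_min !ltr_norml.
  case: (unit_pointP y01) => [->|->|u ->]; first by rewrite -x0.
    by rewrite ltxx !andbF.
  by rewrite arrow_point_inner => /andP[/andP[_ ud] _]; apply: dP.
- move: (Ux); rewrite {1}x1 arrow_point1 => /(basic_open_tgt oU)[d d0 dP].
  exists (Num.min d 1); first by rewrite lt_min d0 ltr01.
  move=> y y01; rewrite x1 lt_min !ltr_norml.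
  case: (unit_pointP y01) => [->|->|u ->]; last first.
  + by rewrite arrow_point_inner => /andP[/andP[ud _] _]; apply: dP; lra.
  + by rewrite -x1.
  + by move=> /andP[_ /andP[]] *; exfalso; lra.
- move: (Ux); rewrite {1}xu arrow_point_inner => /(basic_open_inner oU)[d d0 dP].
  have /andP[u0 u1] := valP u.
  exists (Num.min d (Num.min (val u) (1 - val u))).
    by rewrite !lt_min d0 u0 subr_gt0.
  move=> y y01; rewrite xu !lt_min !ltr_norml.
  case: (unit_pointP y01) => [->|->|u' ->].
  + by move=> /and3P[_ /andP[]] *; exfalso; lra.
  + by move=> /and3P[_ _ /andP[]] *; exfalso; lra.
  + by rewrite arrow_point_inner => /and3P[ud _ _]; apply: dP; rewrite ltr_norml.
Qed.

End Space.

(** * Refining partitions *)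

Section Cells.
Variables (D : digraph) (idx : D -> nat) (r0 : D).
Implicit Types (S X C B : set D) (u v : D).

Definition target B : D :=
  xget r0 [set v | B v /\ forall u, B u -> (idx v <= idx u)%N].

(** Among the out-neighbours of [e] in [B], one at minimal distance from the
    target, so that a component that is always the first one still loses its
    target after finitely many steps. *)
Definition entry e B : D := xget r0 [set b | [/\ B b, edge D e b &
  forall k b', B b' -> edge D e b' -> walk B k b' (target B) ->
    walk B k b (target B)]].

(** The part of [v] after [n] steps, with its entrance. It is a function of
    [v] alone because a step only looks at the previous part of [v]. A vertex
    that was taken out keeps the part [[set v]]. *)
Fixpoint part (n : nat) v : set D * D :=
  if n is m.+1 then
    let: (C, e) := part m v in
    if v == e then ([set v], v) else
    let B := scomp (C `\ e) v in
    (B, if crank (C `\ e) v == 0%N then entry e B else target B)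
  else (setT, r0).

Definition cell n v : set D := (part n v).1.
Definition entrance n v : D := (part n v).2.
Definition rest n v : set D := cell n v `\ entrance n v.
Definition removed n : set D :=
  if n is m.+1 then [set v | entrance m v = v] else set0.

Lemma part_entrance n v : entrance n v = v -> part n.+1 v = ([set v], v).
Proof.
by rewrite /entrance /=; case: (part n v) => C e /= ->; rewrite eqxx.
Qed.

Lemma part_step n v : entrance n v <> v ->
  part n.+1 v = (scomp (rest n v) v,
    if crank (rest n v) v == 0%N then entry (entrance n v) (scomp (rest n v) v)
    else target (scomp (rest n v) v)).
Proof.
rewrite /rest /entrance /cell /=; case: (part n v) => C e /= /eqP.
by rewrite eq_sym => /negbTE ->.
Qed.

Lemma cell_step n v : entrance n v <> v -> cell n.+1 v = scomp (rest n v) v.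
Proof. by move=> /part_step; rewrite {1}/cell => ->. Qed.

Lemma removed_part n v : removed n v -> part n v = ([set v], v).
Proof. by case: n => // n; apply: part_entrance. Qed.

Lemma removed_entrance n v : removed n v -> entrance n v = v.
Proof. by move=> /removed_part; rewrite /entrance => ->. Qed.

Lemma removed_cell n v : removed n v -> cell n v = [set v].
Proof. by move=> /removed_part; rewrite /cell => ->. Qed.

Lemma removedS n : removed n `<=` removed n.+1.
Proof. by move=> v /removed_entrance. Qed.

Lemma removed_le m n : (m <= n)%N -> removed m `<=` removed n.
Proof.
move=> /subnK <-; elim: (n - m)%N => // k IH.
by rewrite addSn; apply: subset_trans IH (@removedS _).
Qed.

Lemma targetP B : B !=set0 ->
  B (target B) /\ forall u, B u -> (idx (target B) <= idx u)%N.
Proof.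
move=> [v Bv].
apply: (@xgetPex _ r0 [set v | B v /\ forall u, B u -> (idx v <= idx u)%N]).
pose P := [pred k | `[< exists2 u, B u & idx u = k >]].
have exP : exists k, P k by exists (idx v); apply/asboolP; exists v.
have [k /asboolP[u Bu uk] kmin] := ex_minnP exP.
exists u; split=> // w Bw; rewrite uk; apply: kmin.
by apply/asboolP; exists w.
Qed.

Lemma entryP e B : strongly_connected B -> (exists2 b, B b & edge D e b) ->
  [/\ B (entry e B), edge D e (entry e B) &
  forall k b', B b' -> edge D e b' -> walk B k b' (target B) ->
    walk B k (entry e B) (target B)].
Proof.
move=> [B0 Bst] [b Bb eb]; apply: (@xgetPex _ r0 [set b | [/\ B b, edge D e b &
  forall k b', B b' -> edge D e b' -> walk B k b' (target B) ->
    walk B k b (target B)]]).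
have [Bt _] := targetP B0.
pose P := [pred k | `[< exists b', [/\ B b', edge D e b' & walk B k b' (target B)] >]].
have exP : exists k, P k.
  have [k bk] := reach_walk (Bst _ _ Bb Bt).
  by exists k; apply/asboolP; exists b.
have [k /asboolP[u [Bu eu uk]] kmin] := ex_minnP exP.
exists u; split=> // l b' Bb' eb' b'l; apply: walk_le uk; apply: kmin.
by apply/asboolP; exists b'.
Qed.

Hypothesis tournament_D : tournament D.
Hypothesis solid_D : solid D.
Hypothesis idx_inj : injective idx.
Hypothesis r0_reach : forall v, v <> r0 -> reach r0 v.

Record cells_inv n : Prop := CellsInv {
  inv_self : forall v, cell n v v;
  inv_part : forall v u, cell n v u -> part n u = part n v;
  inv_entrance : forall v, cell n v (entrance n v);
  inv_reach : forall v u, cell n v u -> reach_in (cell n v) (entrance n v) u;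
  inv_fin : finite_set (removed n);
  inv_cell : forall v, ~ removed n v ->
    scomp (~` removed n) v `<=` cell n v /\ cell n v `<=` ~` removed n }.

Section Step.
Variables (n : nat) (In : cells_inv n).

Lemma inv_cellE v u : cell n v u -> cell n u = cell n v.
Proof. by move=> /(inv_part In); rewrite /cell => ->. Qed.

Lemma inv_entranceE v u : cell n v u -> entrance n u = entrance n v.
Proof. by move=> /(inv_part In); rewrite /entrance => ->. Qed.

Lemma inv_restE v u : cell n v u -> rest n u = rest n v.
Proof. by move=> vu; rewrite /rest (inv_cellE vu) (inv_entranceE vu). Qed.

Lemma inv_rest_self v : entrance n v <> v -> rest n v v.
Proof. by move=> nv; split; [apply: inv_self|move=> /= e; apply: nv]. Qed.

(** The entrances of the other parts are deleted as well in [removed n.+1], but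
    a strong component of the smaller digraph lies inside one part. *)
Lemma inv_rest_scomp v : entrance n v <> v ->
  scomp (rest n v) v = scomp (~` removed n.+1) v.
Proof.
move=> nv; have nrv : ~ removed n v by move=> /removed_entrance.
have [sub1 sub2] := inv_cell In nrv.
apply/seteqP; split.
  apply: scompS => u [vu ue] /= eu; apply: ue => /=.
  by rewrite -eu; apply: inv_entranceE.
have nrv1 : ~ removed n.+1 v by [].
apply: strong_sub_scomp; [|exact: scomp_strong|exact: scomp_refl].
move=> u vu; split.
  by apply: sub1; apply: scompS vu; apply: subsetC; apply: removedS.
move=> /= ue; have /scomp_sub : scomp (~` removed n.+1) v u by [].
by apply; rewrite /= ue; apply/inv_entranceE/inv_entrance.
Qed.

(** Each unremoved entrance is determined by its strong component of
    [D - removed n], and solidity bounds the number of these. *)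
Lemma finite_removedS : finite_set (removed n.+1).
Proof.
pose g (C : set D) := xget r0 [set v | C v /\ entrance n v = v].
apply: (@sub_finite_set _ _ (removed n `|` g @` strong_component (removed n))).
  move=> v ev; have [rv|nrv] := pselect (removed n v); first by left.
  right; exists (scomp (~` removed n) v).
    exact: strong_component_scomp.
  have [vg eg] : [set u | scomp (~` removed n) v u /\ entrance n u = u]
      (g (scomp (~` removed n) v)).
    by apply: xgetPex; exists v; split=> //; apply: scomp_refl.
  have := inv_entranceE ((inv_cell In nrv).1 _ vg).
  by rewrite eg ev.
rewrite finite_setU; split; first exact: inv_fin.
by apply: finite_image; apply: solid_D; apply: inv_fin.
Qed.

Lemma inv_rest_fin v : finite_set (strong_component (~` rest n v)).
Proof.
apply: (sub_finite_set _ (solid_D finite_removedS)) => K Kc.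
have [Ks [[u Ku] _] _] := Kc.
have := Ks _ Ku; rewrite setCK => vu.
rewrite (strong_componentE Kc Ku) setCK -(inv_restE vu.1).
have nu : entrance n u <> u by rewrite (inv_entranceE vu.1) => e; case: vu => _; apply.
by rewrite inv_rest_scomp //; apply: strong_component_scomp.
Qed.

Lemma rest_scomp_strong v : entrance n v <> v -> strongly_connected (scomp (rest n v) v).
Proof. by move=> nv; apply/scomp_strong/inv_rest_self. Qed.

(** Walks outside the entrance do not decrease the rank, so a walk that ends in
    the component of rank [0] has been there since its second vertex. *)
Lemma walk_first_component v k : entrance n v <> v -> crank (rest n v) v = 0%N ->
  walk (cell n v) k (entrance n v) v ->
  exists2 b, edge D (entrance n v) b & walk (scomp (rest n v) v) k.-1 b v.
Proof.
move=> nv rk0 /walk_tail[//|b eb bv]; exists b => //.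
have bv' := walk_reach bv; have [rb rv] := reach_in_mem bv'.
have rkb : crank (rest n v) b = 0%N.
  by apply/eqP; rewrite -leqn0 -rk0 reach_crank //; apply: inv_rest_fin.
have e : scomp (rest n v) b = scomp (rest n v) v.
  by apply: (crank_inj tournament_D (@inv_rest_fin v)); rewrite ?rk0.
have vb : scomp (rest n v) v b by rewrite -e; apply: scomp_refl.
by rewrite -e; apply: walk_scomp vb.1 bv.
Qed.

Lemma first_component_out v : entrance n v <> v -> crank (rest n v) v = 0%N ->
  exists2 b, scomp (rest n v) v b & edge D (entrance n v) b.
Proof.
move=> nv rk0; have [k] := reach_walk (inv_reach In (inv_self In v)).
move=> /walk_first_component[//|//|b eb /walk_reach bv].
by exists b => //; case: (reach_in_mem bv).
Qed.

Lemma entranceS_mem v : entrance n v <> v -> scomp (rest n v) v (entrance n.+1 v).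
Proof.
move=> nv; have st := rest_scomp_strong nv.
rewrite /entrance part_step //=; case: eqP => rk0.
  by have [] := entryP st (first_component_out nv rk0).
by have [] := targetP st.1.
Qed.

Lemma entranceS_edge v : entrance n v <> v -> crank (rest n v) v = 0%N ->
  edge D (entrance n v) (entrance n.+1 v).
Proof.
move=> nv rk0; rewrite [entrance n.+1 v]/entrance part_step //= rk0 eqxx.
by have [] := entryP (rest_scomp_strong nv) (first_component_out nv rk0).
Qed.

Lemma cellS_sub v : cell n.+1 v `<=` cell n v.
Proof.
have [ev|nv] := pselect (entrance n v = v).
  by rewrite {1}/cell part_entrance //= => u ->; apply: inv_self.
by rewrite cell_step // => u /scomp_sub[].
Qed.

Lemma cells_invS : cells_inv n.+1.
Proof.
have self v : cell n.+1 v v.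
  have [ev|nv] := pselect (entrance n v = v); first by rewrite /cell part_entrance.
  by rewrite cell_step //; apply: scomp_refl; apply: inv_rest_self.
split=> //.
- move=> v u; have [ev|nv] := pselect (entrance n v = v).
    by move=> vu; have -> : u = v by move: vu; rewrite /cell part_entrance.
  rewrite cell_step // => vu; have [cvu uv] := scomp_sub vu.
  rewrite !part_step ?(inv_restE cvu) ?(inv_entranceE cvu) ?(scomp_eq vu) ?(crank_scomp vu) //.
  by move=> /esym.
- move=> v; have [ev|nv] := pselect (entrance n v = v).
    by rewrite /cell /entrance part_entrance.
  by rewrite cell_step //; apply: entranceS_mem.
- move=> v u; have [ev|nv] := pselect (entrance n v = v).
    rewrite /cell /entrance part_entrance //= => ->; exact: reach_in_refl.
  rewrite cell_step // => vu; have [_] := rest_scomp_strong nv; apply => //.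
  exact: entranceS_mem.
- exact: finite_removedS.
- move=> v /= nv; rewrite cell_step // inv_rest_scomp //; split=> //.
  exact: scomp_sub.
Qed.

End Step.

Lemma cells_invP n : cells_inv n.
Proof.
elim: n => [|n /cells_invS//]; split=> //.
- move=> v u _; have [->|/r0_reach//] := pselect (u = r0).
  exact: reach_in_refl.
- by move=> v _; split=> //; rewrite setC0.
Qed.

Lemma cell_self n v : cell n v v.
Proof. exact: inv_self (cells_invP n) _. Qed.

Lemma cellE n v u : cell n v u -> cell n u = cell n v.
Proof. exact: inv_cellE (cells_invP n) _ _. Qed.

Lemma entranceE n v u : cell n v u -> entrance n u = entrance n v.
Proof. exact: inv_entranceE (cells_invP n) _ _. Qed.

Lemma restE n v u : cell n v u -> rest n u = rest n v.
Proof. exact: inv_restE (cells_invP n) _ _. Qed.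

Lemma cell_entrance n v : cell n v (entrance n v).
Proof. exact: inv_entrance (cells_invP n) _. Qed.

Lemma rest_self n v : entrance n v <> v -> rest n v v.
Proof. exact: inv_rest_self (cells_invP n) _. Qed.

Lemma rest_fin n v : finite_set (strong_component (~` rest n v)).
Proof. exact: inv_rest_fin (cells_invP n) _. Qed.

Lemma removed_fin n : finite_set (removed n).
Proof. exact: inv_fin (cells_invP n). Qed.

Lemma cell_strong_component n v : (0 < n)%N -> ~ removed n v ->
  strong_component (removed n) (cell n v).
Proof.
case: n => // n _ nv; have nv' : entrance n v <> v by [].
rewrite cell_step // (inv_rest_scomp (cells_invP n)) //.
exact: strong_component_scomp.
Qed.

Lemma cell_sub n m v : (n <= m)%N -> cell m v `<=` cell n v.
Proof.
move=> /subnK <-; elim: (m - n)%N => // k; rewrite addSn; apply: subset_trans.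
exact: cellS_sub (cells_invP _) _.
Qed.

(** By induction on the index, all vertices of smaller index are removed at some
    step, after which [v] is the target of its part. From then on, a step either
    puts [v] into a component of positive rank, where it becomes the entrance, or
    brings the entrance closer to [v]. *)
Lemma eventually_removed v : exists n, removed n v.
Proof.
have [m] := ubnP (idx v); elim: m v => // m IH v vm.
have [N NP] : exists N, forall u, (idx u < idx v)%N -> removed N u.
  have : (idx v <= m)%N by []; move: (idx v) => k.
  elim: k => [|k IHk] km; first by exists 0%N.
  have [N NP] := IHk (ltnW km).
  have [[w wk]|no] := pselect (exists w, idx w = k).
    have [] := IH w; first by rewrite wk.
    move=> M wM; exists (maxn N M) => u; rewrite ltnS leq_eqVlt => /orP[/eqP uk|uk].
      have -> : u = w by apply: idx_inj; rewrite uk.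
      by apply: removed_le wM; apply: leq_maxr.
    by apply: removed_le (NP _ uk); apply: leq_maxl.
  exists N => u; rewrite ltnS leq_eqVlt => /orP[/eqP uk|/NP//].
  by case: no; exists u.
apply: contrapT => never.
have nv n : entrance n v <> v by move=> ev; apply: never; exists n.+1.
have targetE n : (N <= n)%N -> target (cell n v) = v.
  move=> Nn; have [|tC tmin] := @targetP (cell n v).
    by exists v; apply: cell_self.
  have := tmin _ (cell_self n v); rewrite leq_eqVlt => /orP[/eqP/idx_inj//|/NP].
  move=> /(removed_le Nn)/removed_cell tE.
  apply/esym; suff : [set target (cell n v)] v by [].
  by rewrite -tE (cellE tC); apply: cell_self.
suff far k n : (N <= n)%N -> ~ walk (cell n v) k (entrance n v) v.
  have [k] := reach_walk (inv_reach (cells_invP N) (cell_self N v)).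
  by apply: far.
elim: k n => [|k IHk] n Nn wk.
  have [p [_ lp _]] := wk; rewrite leqn0 size_eq0 => /eqP pE.
  by apply: (nv n); rewrite pE in lp.
have NSn : (N <= n.+1)%N by apply: leqW.
have tE := targetE _ NSn; rewrite cell_step // in tE.
have [rk0|/eqP/negbTE rk] := pselect (crank (rest n v) v = 0%N).
  apply: (IHk n.+1) => //; rewrite cell_step //.
  have [b eb bv] := walk_first_component (cells_invP n) (nv n) rk0 wk.
  have Bb := (reach_in_mem (walk_reach bv)).1.
  rewrite /entrance part_step //= rk0 eqxx.
  have ex : exists2 b, scomp (rest n v) v b & edge D (entrance n v) b by exists b.
  have [_ _ /(_ k b Bb eb)] := entryP (rest_scomp_strong (cells_invP n) (nv n)) ex.
  by rewrite tE; apply.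
by apply: (nv n.+1); rewrite /entrance part_step //= rk.
Qed.

Lemma finite_removed X : finite_set X -> exists n, X `<=` removed n.
Proof.
move=> /finite_seqP[s ->]; elim: s => [|v s [n sn]].
  by exists 0%N => v /=; rewrite in_nil.
have [m vm] := eventually_removed v; exists (maxn n m) => u /=.
rewrite inE => /orP[/eqP->|us].
  by apply: removed_le vm; apply: leq_maxr.
by apply: removed_le (sn u us); apply: leq_maxl.
Qed.

(** * Intervals of time *)

Variable R : realType.
Implicit Types (s t : R).

(** The entrance of a part gets the first half of the interval of the part, or
    all of it if the part has no other vertex; the components of the rest share
    the second half equally. The root interval from [-1] to
    [1] makes [r0], which has no incoming arrow to traverse, arrive exactly at
    time [0]. *)
Fixpoint bounds (n : nat) v : R * R :=
  if n is m.+1 then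
    let: (a, b) := bounds m v in
    let mid := (a + b) / 2 in
    let gap := (b - mid) / (ncomp (rest m v))%:R in
    if v == entrance m v then (a, if ncomp (rest m v) == 0%N then b else mid)
    else (mid + gap * (crank (rest m v) v)%:R,
          mid + gap * (crank (rest m v) v).+1%:R)
  else (-1, 1).

Definition lo n v : R := (bounds n v).1.
Definition hi n v : R := (bounds n v).2.
Definition mid n v : R := (lo n v + hi n v) / 2.
Definition gap n v : R := (hi n v - mid n v) / (ncomp (rest n v))%:R.

Lemma bounds_entrance n v : entrance n v = v -> bounds n.+1 v =
  (lo n v, if ncomp (rest n v) == 0%N then hi n v else mid n v).
Proof. by move=> ev; rewrite /mid /lo /hi /= ev eqxx; case: (bounds n v). Qed.

Lemma bounds_step n v : entrance n v <> v -> bounds n.+1 v =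
  (mid n v + gap n v * (crank (rest n v) v)%:R,
   mid n v + gap n v * (crank (rest n v) v).+1%:R).
Proof.
move=> /eqP; rewrite eq_sym => /negbTE ev; rewrite /gap /mid /lo /hi /= ev.
by case: (bounds n v).
Qed.

Lemma lo_entranceS n v : entrance n v = v -> lo n.+1 v = lo n v.
Proof. by move=> ev; rewrite /lo bounds_entrance. Qed.

Lemma hi_entranceS n v : entrance n v = v -> hi n.+1 v =
  if ncomp (rest n v) == 0%N then hi n v else mid n v.
Proof. by move=> ev; rewrite /hi bounds_entrance. Qed.

Lemma lo_step n v : entrance n v <> v ->
  lo n.+1 v = mid n v + gap n v * (crank (rest n v) v)%:R.
Proof. by move=> nv; rewrite /lo bounds_step. Qed.

Lemma hi_step n v : entrance n v <> v ->
  hi n.+1 v = mid n v + gap n v * (crank (rest n v) v).+1%:R.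
Proof. by move=> nv; rewrite /hi bounds_step. Qed.

Lemma ncomp_gt0 n v u : rest n v u -> (0 < ncomp (rest n v))%N.
Proof. by move=> vu; apply: leq_ltn_trans (crank_lt tournament_D (@rest_fin n v) vu). Qed.

Lemma ncomp_exists n v : (0 < ncomp (rest n v))%N ->
  exists2 u, rest n v u & crank (rest n v) u = 0%N.
Proof. exact: (crank_surj tournament_D (@rest_fin n v)). Qed.

Lemma gap_ncomp n v : (0 < ncomp (rest n v))%N ->
  gap n v * (ncomp (rest n v))%:R = hi n v - mid n v.
Proof. by move=> m0; rewrite divfK // pnatr_eq0 -lt0n. Qed.

Lemma step_bounds n v : entrance n v <> v -> lo n v < hi n v ->
  [/\ 0 < gap n v, mid n v <= lo n.+1 v, hi n.+1 v <= hi n v,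
      hi n.+1 v = lo n.+1 v + gap n v & gap n v <= (hi n v - lo n v) / 2].
Proof.
move=> nv lh; have vv := rest_self nv; have m0 := ncomp_gt0 vv.
have gE := gap_ncomp m0.
have rk := crank_lt tournament_D (@rest_fin n v) vv.
rewrite lo_step // hi_step //.
have mE : mid n v = (lo n v + hi n v) / 2 by [].
have g0 : 0 < gap n v.
  by rewrite divr_gt0 ?ltr0n // mE; lra.
have rkm : (crank (rest n v) v).+1%:R <= (ncomp (rest n v))%:R :> R.
  by rewrite ler_nat.
have r0' : 0 <= (crank (rest n v) v)%:R :> R by rewrite ler0n.
have := ler_wpM2l (ltW g0) rkm; rewrite gE => le1.
have := mulr_ge0 (ltW g0) r0'.
have SE : gap n v * (crank (rest n v) v).+1%:R =
    gap n v * (crank (rest n v) v)%:R + gap n v.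
  by rewrite -natr1 mulrDr mulr1.
rewrite SE in le1 *; split=> //; lra.
Qed.

Lemma lo_lt_hi n v : lo n v < hi n v.
Proof.
elim: n v => [|n IH] v; first by rewrite /lo /hi /=; lra.
have := IH v; have [ev|nv] := pselect (entrance n v = v).
  rewrite lo_entranceS // hi_entranceS // /mid; case: ifP => _; lra.
by move=> /(step_bounds nv)[]; lra.
Qed.

Lemma bounds_same n v u : cell n v u -> bounds n u = bounds n v.
Proof.
elim: n v u => // n IH v u.
have [ev|nv] := pselect (entrance n v = v).
  by move=> vu; have -> : u = v by move: vu; rewrite /cell part_entrance.
rewrite cell_step // => vu; have [cvu uv] := scomp_sub vu.
rewrite !bounds_step ?(entranceE cvu) //; last by move=> /esym.
by rewrite /gap /mid /lo /hi (IH _ _ cvu) (restE cvu) (crank_scomp vu).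
Qed.

Lemma lo_same n v u : cell n v u -> lo n u = lo n v.
Proof. by rewrite /lo => /bounds_same->. Qed.

Lemma hi_same n v u : cell n v u -> hi n u = hi n v.
Proof. by rewrite /hi => /bounds_same->. Qed.

Lemma mid_same n v u : cell n v u -> mid n u = mid n v.
Proof. by move=> vu; rewrite /mid (lo_same vu) (hi_same vu). Qed.

Lemma gap_same n v u : cell n v u -> gap n u = gap n v.
Proof. by move=> vu; rewrite /gap (mid_same vu) (hi_same vu) (restE vu). Qed.

Lemma lo_lt_mid n v : lo n v < mid n v.
Proof. by have := lo_lt_hi n v; rewrite /mid; lra. Qed.

Lemma mid_lt_hi n v : mid n v < hi n v.
Proof. by have := lo_lt_hi n v; rewrite /mid; lra. Qed.

Lemma gap_gt0 n v : entrance n v <> v -> 0 < gap n v.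
Proof. by move=> nv; have [] := step_bounds nv (lo_lt_hi n v). Qed.

Lemma mid_le_lo n v : entrance n v <> v -> mid n v <= lo n.+1 v.
Proof. by move=> nv; have [] := step_bounds nv (lo_lt_hi n v). Qed.

Lemma lo_le n m v : (n <= m)%N -> lo n v <= lo m v.
Proof.
move=> /subnK <-; elim: (m - n)%N => // k IH; rewrite addSn; apply: le_trans IH _.
have [ev|nv] := pselect (entrance (k + n) v = v); first by rewrite lo_entranceS.
exact/ltW/(lt_le_trans (lo_lt_mid _ _))/mid_le_lo.
Qed.

Lemma hi_le n m v : (n <= m)%N -> hi m v <= hi n v.
Proof.
move=> /subnK <-; elim: (m - n)%N => // k IH; rewrite addSn; apply: le_trans _ IH.
have [ev|nv] := pselect (entrance (k + n) v = v).
  by rewrite hi_entranceS //; case: ifP => // _; exact/ltW/mid_lt_hi.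
by have [] := step_bounds nv (lo_lt_hi _ v).
Qed.

Lemma interval_disjoint n u v : ~ cell n v u ->
  hi n u <= lo n v \/ hi n v <= lo n u.
Proof.
elim: n => [|n IH] in u v *; first by case.
move=> nvu; have [vu|nvu'] := pselect (cell n v u); last first.
  have leS w : lo n w <= lo n.+1 w /\ hi n.+1 w <= hi n w by rewrite lo_le ?hi_le.
  have [lu hu] := leS u; have [lv hv] := leS v.
  by have [H|H] := IH _ _ nvu'; [left|right]; lra.
have := vu; have [ev|nv] := pselect (entrance n v = v).
  have nu : entrance n u <> u.
    rewrite (entranceE vu) ev => uv; apply: nvu; rewrite -uv; exact: cell_self.
  move=> _; right; rewrite hi_entranceS //.
  have /ncomp_gt0 : rest n v u.
    by rewrite -(restE vu); apply: rest_self.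
  rewrite lt0n => /negbTE ->.
  by rewrite -(mid_same vu) mid_le_lo.
have [eu|nu] := pselect (entrance n u = u).
  move=> _; left; rewrite hi_entranceS //.
  have /ncomp_gt0 : rest n u v.
    by rewrite (restE vu); apply: rest_self.
  rewrite lt0n => /negbTE ->.
  by rewrite (mid_same vu) mid_le_lo.
move=> _; have rv := rest_self nv.
have ru : rest n v u by rewrite -(restE vu); apply: rest_self.
rewrite !lo_step // !hi_step // (mid_same vu) (gap_same vu) (restE vu).
rewrite !lerD2l !ler_pM2l ?gap_gt0 // !ler_nat.
case: (ltngtP (crank (rest n v) u) (crank (rest n v) v)) => [|/ltnW|rk].
- by left.
- by right.
case: nvu; rewrite cell_step //.
rewrite -(crank_inj tournament_D (@rest_fin n v) ru rv rk).
exact: scomp_refl.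
Qed.

Definition during n v t : bool := lo n v < t <= hi n v.

Lemma during_le n m v t : (n <= m)%N -> during m v t -> during n v t.
Proof.
move=> nm /andP[lt th]; apply/andP; split.
  exact: le_lt_trans (lo_le v nm) lt.
exact: le_trans th (hi_le v nm).
Qed.

Lemma during_cell n u v t : during n v t -> during n u t -> cell n v u.
Proof.
move=> /andP[lv hv] /andP[lu hu]; apply: contrapT.
by move=> /interval_disjoint[]; lra.
Qed.

Lemma cell_during n u v t : cell n v u -> during n u t = during n v t.
Proof. by move=> vu; rewrite /during (lo_same vu) (hi_same vu). Qed.

Lemma during_ex n t : -1 < t <= 1 -> exists v, during n v t.
Proof.
move=> t1; elim: n => [|n [v /andP[lt th]]]; first by exists r0.
set e := entrance n v; have ve : cell n v e by apply: cell_entrance.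
have ee : entrance n e = e by apply: entranceE.
have [/eqP m0|m0] := boolP (ncomp (rest n v) == 0%N).
  exists e; rewrite /during lo_entranceS // hi_entranceS // (restE ve) m0 eqxx.
  by rewrite (lo_same ve) (hi_same ve) lt.
have [tm|mt] := leP t (mid n v).
  exists e; rewrite /during lo_entranceS // hi_entranceS // (restE ve) (negbTE m0).
  by rewrite (lo_same ve) (mid_same ve) lt.
have m0' : (0 < ncomp (rest n v))%N by rewrite lt0n.
(* The component sought is the first one whose interval ends at [t] or later. *)
have exi : exists i, t <= mid n v + gap n v * i.+1%:R.
  exists (ncomp (rest n v)).-1; rewrite prednK // gap_ncomp //; lra.
case: (ex_minnP exi) => i ti imin.
have im : (i < ncomp (rest n v))%N.
  rewrite -(prednK m0') ltnS; apply: imin; rewrite prednK // gap_ncomp //; lra.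
have [u vu rku] := crank_surj tournament_D (@rest_fin n v) im.
have nu : entrance n u <> u.
  by rewrite (entranceE vu.1) => eu; case: vu => _; apply; rewrite /= eu.
exists u; rewrite /during lo_step // hi_step //.
rewrite (mid_same vu.1) (gap_same vu.1) (restE vu.1) rku ti andbT.
case: i ti imin im rku => [|i] ti imin im rku; first by rewrite mulr0 addr0.
by rewrite ltNge; apply/negP => /imin; rewrite ltnn.
Qed.

(** Refinement preserves this: the last piece of a part [C] is a subset of [C],
    the first piece of the next part is its entrance, and inside a part the
    pieces are linked by the choice of the entrance of the first component and
    by domination. *)
Lemma consecutive_edge n u v x : hi n u = lo n v -> cell n u x ->
  edge D x (entrance n v).
Proof.
elim: n => [|n IH] in u v x *; first by rewrite /hi /lo /=; lra.
move=> uv ux; have [vu|nvu] := pselect (cell n v u); last first.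
  have loS := lo_le v (leqnSn n).
  have hiS := hi_le u (leqnSn n).
  have uv' : hi n u = lo n v.
    have [//|vu'] := interval_disjoint nvu; first by lra.
    by have := lo_lt_hi n.+1 u; have := lo_lt_hi n.+1 v;
      have := lo_le u (leqnSn n); have := hi_le v (leqnSn n); lra.
  have [ev|nv] := pselect (entrance n v = v); last first.
    by have := mid_le_lo nv; have := lo_lt_mid n v; lra.
  have -> : entrance n.+1 v = entrance n v by rewrite ev /entrance part_entrance.
  apply: IH uv' _.
  exact: (@cell_sub n n.+1).
have [ev|nv] := pselect (entrance n v = v).
  have := lo_le u (leqnSn n); rewrite (lo_same vu) -(lo_entranceS ev).
  by have := lo_lt_hi n.+1 u; lra.
have [eu|nu] := pselect (entrance n u = u).
  have -> : x = u by move: ux; rewrite /cell part_entrance.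
  rewrite -eu (entranceE vu); apply: (entranceS_edge (cells_invP n)) => //.
  have /ncomp_gt0 : rest n u v.
    by rewrite (restE vu); apply: rest_self.
  move: uv; rewrite hi_entranceS // lo_step // (mid_same vu) => + m0.
  rewrite eqn0Ngt m0 /= => /eqP; rewrite -subr_eq0 opprD addrA subrr add0r oppr_eq0.
  by rewrite mulf_eq0 (gt_eqF (gap_gt0 nv)) /= pnatr_eq0 => /eqP.
have rv := rest_self nv.
have ru : rest n v u by rewrite -(restE vu); apply: rest_self.
move: uv; rewrite hi_step // lo_step // (mid_same vu) (gap_same vu) (restE vu).
move=> /addrI/mulfI; rewrite (gt_eqF (gap_gt0 nv)) => /(_ isT)/eqP.
rewrite eqr_nat => /eqP rk.
apply: (crank_dominates tournament_D (@rest_fin n v) ru rv).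
- by rewrite -rk.
- by move: ux; rewrite cell_step // (restE vu).
- exact: (entranceS_mem (cells_invP n)).
Qed.

(** The interval of the last component ends with that of the whole part, which
    is followed by the entrance of the next part. *)
Lemma next_part n u : hi n u < 1 -> exists2 v, entrance n v = v & lo n v = hi n u.
Proof.
suff H : hi n u < 1 -> exists v, lo n v = hi n u.
  move=> /H[v lv]; exists (entrance n v); first exact/entranceE/cell_entrance.
  by rewrite (lo_same (@cell_entrance n v)).
elim: n u => [|n IH] u; first by rewrite /hi /= ltxx.
have last_case : hi n.+1 u = hi n u -> hi n.+1 u < 1 ->
    exists v, lo n.+1 v = hi n.+1 u.
  move=> -> /IH[v lv]; exists (entrance n v); rewrite lo_entranceS; last exact/entranceE/cell_entrance.
  by rewrite (lo_same (@cell_entrance n v)).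
have [eu|nu] := pselect (entrance n u = u).
  have := hi_entranceS eu; case: ifP => [_|/negbT m0] hE; first exact: last_case.
  move=> _; rewrite -lt0n in m0; have [v uv rv] := ncomp_exists m0.
  exists v; rewrite lo_step; first by rewrite (mid_same uv.1) (restE uv.1) rv mulr0 addr0.
  by rewrite (entranceE uv.1) => ev; case: uv => _; apply.
have ru := rest_self nu; have := crank_lt tournament_D (@rest_fin n u) ru.
rewrite leq_eqVlt => /orP[/eqP lst|lst].
  apply: last_case; rewrite hi_step // lst gap_ncomp ?(ncomp_gt0 ru) //; lra.
move=> _; have [v uv rv] := crank_surj tournament_D (@rest_fin n u) lst.
exists v; rewrite lo_step.
  by rewrite (mid_same uv.1) (restE uv.1) (gap_same uv.1) rv hi_step.
by rewrite (entranceE uv.1) => ev; case: uv => _; apply.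
Qed.

Lemma width_le n v : ~ removed n v -> hi n v - lo n v <= 2 / n.+1%:R.
Proof.
elim: n v => [|n IH] v; first by rewrite /hi /lo /=; lra.
move=> nv; have nv' : entrance n v <> v by [].
have [_ _ _ -> gle] := step_bounds nv' (lo_lt_hi n v).
have := IH v (fun rv => nv (removedS rv)).
have n1 : 0 < n.+1%:R :> R by rewrite ltr0n.
have n2 : 0 < n.+2%:R :> R by rewrite ltr0n.
have : 1 / n.+1%:R <= 2 / n.+2%:R :> R.
  rewrite ler_pdivrMr // mulrAC ler_pdivlMr // mul1r -natrM ler_nat; lia.
rewrite div1r; move: (n.+1%:R^-1) (2 / n.+2%:R) => p q; lra.
Qed.

Lemma shrink (eps : R) : 0 < eps ->
  exists n, forall v, ~ removed n v -> hi n v - lo n v < eps.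
Proof.
move=> e0; exists (Num.truncn (2 / eps)) => v /width_le/le_lt_trans; apply.
rewrite ltr_pdivrMr ?ltr0n // -ltr_pdivrMl // mulrC.
exact: truncnS_gt.
Qed.

(** * Departure and arrival of the vertices *)

Hypothesis nontrivial : exists v, v <> r0.

Lemma removed_bounds n m v : removed n v -> (n <= m)%N -> bounds m v = bounds n v.
Proof.
move=> rv /subnK <-; elim: (m - n)%N => // k IH; rewrite addSn.
have rkv : removed (k + n) v by apply: removed_le rv; apply: leq_addl.
rewrite bounds_entrance ?removed_entrance // -IH /lo /hi.
case: eqP => [_|/eqP]; first by case: (bounds _ v).
rewrite -lt0n => /ncomp_exists[u [+ + _]].
by rewrite removed_cell // removed_entrance.
Qed.

Definition depth v : nat := xget 0%N [set n | removed n v].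
Definition depart v : R := lo (depth v) v.
Definition arrive v : R := hi (depth v) v.

Lemma depthP v : removed (depth v) v.
Proof.
exact: (@xgetPex _ 0%N [set n | removed n v] (eventually_removed v)).
Qed.

Lemma bounds_removed n v : removed n v -> bounds n v = (depart v, arrive v).
Proof.
move=> rv; rewrite /depart /arrive /lo /hi -surjective_pairing.
have [node_of|dn] := leqP n (depth v); first by rewrite (removed_bounds rv node_of).
by rewrite (removed_bounds (depthP v) (ltnW dn)).
Qed.

Lemma lo_removed n v : removed n v -> lo n v = depart v.
Proof. by rewrite /lo => /bounds_removed->. Qed.

Lemma hi_removed n v : removed n v -> hi n v = arrive v.
Proof. by rewrite /hi => /bounds_removed->. Qed.

Lemma lo_entrance n v : entrance n v = v -> lo n v = depart v.
Proof. by move=> ev; rewrite -lo_entranceS // lo_removed. Qed.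

Lemma removed_depth n v : (depth v <= n)%N -> removed n v.
Proof. by move=> /removed_le; apply; apply: depthP. Qed.

Lemma lo_le_depart n v : lo n v <= depart v.
Proof.
rewrite -(@lo_removed (maxn n (depth v)) v) ?lo_le ?leq_maxl //.
exact/removed_depth/leq_maxr.
Qed.

Lemma arrive_le_hi n v : arrive v <= hi n v.
Proof.
rewrite -(@hi_removed (maxn n (depth v)) v) ?hi_le ?leq_maxl //.
exact/removed_depth/leq_maxr.
Qed.

Lemma depart_lt_arrive v : depart v < arrive v.
Proof. exact: lo_lt_hi. Qed.

Lemma arrive_le1 v : arrive v <= 1.
Proof. exact: (arrive_le_hi 0 v). Qed.

Lemma during_removed n v t : removed n v -> during n v t = (depart v < t <= arrive v).
Proof. by move=> rv; rewrite /during lo_removed // hi_removed. Qed.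

Lemma during_vertex n v t : depart v < t <= arrive v -> during n v t.
Proof.
move=> /andP[at_ tb]; apply/andP; split.
  exact: le_lt_trans (lo_le_depart n v) at_.
exact: le_trans tb (arrive_le_hi n v).
Qed.

Lemma positions_disjoint u v t :
  depart u < t <= arrive u -> depart v < t <= arrive v -> u = v.
Proof.
move=> ut vt; have := during_cell (during_vertex (depth v) vt) (during_vertex _ ut).
by rewrite removed_cell //; apply: depthP.
Qed.

Lemma positions_overlap u v : depart u < arrive v -> depart v < arrive u -> u = v.
Proof.
move=> uv vu; have := depart_lt_arrive u; have := depart_lt_arrive v => av au.
apply: (@positions_disjoint _ _ (Num.min (arrive u) (arrive v)));
  by rewrite lt_min ge_min lexx ?orbT andbT; apply/andP.
Qed.

Lemma arrive_inj : injective arrive.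
Proof.
move=> u v uv; apply: (@positions_disjoint _ _ (arrive u)); rewrite ?lexx ?depart_lt_arrive //.
by rewrite uv lexx depart_lt_arrive.
Qed.

Lemma next_vertex n u : hi n u < 1 -> exists v, depart v = hi n u.
Proof. by move=> /next_part[v ev <-]; exists v; rewrite lo_entrance. Qed.

Lemma depart_r0 : depart r0 = -1.
Proof. by rewrite -(@lo_entrance 0). Qed.

Lemma arrive_r0 : arrive r0 = 0.
Proof.
rewrite -(@hi_removed 1) // hi_entranceS //.
have [v vr] := nontrivial.
have /ncomp_gt0 : rest 0 r0 v by [].
by rewrite lt0n => /negbTE ->; rewrite /mid /lo /hi /= addNr mul0r.
Qed.

Lemma lo_ge0 n v : v <> r0 -> 0 <= lo n.+1 v.
Proof.
move=> vr; apply: le_trans (lo_le v (ltn0Sn n)).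
have nv : entrance 0 v <> v by move=> /esym.
apply: le_trans (mid_le_lo nv).
by rewrite /mid /lo /hi /= addNr mul0r.
Qed.

Lemma depart_ge0 v : v <> r0 -> 0 <= depart v.
Proof. by move=> /(@lo_ge0 0)/le_trans; apply; apply: lo_le_depart. Qed.

Lemma inside_neq_r0 v t : 0 <= t -> depart v < t < arrive v -> v <> r0.
Proof. by move=> t0 /andP[_ tb] vr; rewrite vr arrive_r0 in tb; lra. Qed.

(** * The vertex or end reached at a given time *)

Definition node_in n v (x : node D) : Prop :=
  match x with
  | inl u => cell n v u
  | inr w => exists2 s, end_rays w s & forall k, cell n v (s k)
  end.

(** For ends, it is enough that rays of the end stay in each of the cells that are
    visited at time [t]; since a ray is injective, this also excludes the times
    at which some [v] is approached or reached. *)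
Definition node_at t (x : node D) : Prop :=
  match x with
  | inl u => t = arrive u
  | inr w => forall n v, during n v t -> node_in n v (inr w)
  end.

Lemma node_at_in n v t (x : node D) : node_at t x -> during n v t -> node_in n v x.
Proof.
case: x => [u ->|w]; last exact.
by move=> /during_cell; apply; apply: during_vertex; rewrite depart_lt_arrive lexx.
Qed.

(** The cell [[set v]] contains no ray. *)
Lemma node_at_end_uncovered t w v : node_at t (inr w) -> ~ depart v < t <= arrive v.
Proof.
move=> tw vt; have [s ws sv] := tw _ _ (during_vertex (depth v) vt).
have [[inj_s _] _] := end_rays_solid ws.
have := sv 0%N; have := sv 1%N; rewrite removed_cell /=; last exact: depthP.
by move=> e1; rewrite -e1 => /inj_s.
Qed.

(** The cells visited at time [t] are never single removed vertices, and their
    entrances are linked by [ray_through]: if the next cell is not the first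
    component, then the entrance of that first component serves as the
    intermediate vertex. *)
Lemma node_at_ex t : -1 < t <= 1 -> ~ (exists v, depart v < t < arrive v) ->
  exists x : node D, node_at t x.
Proof.
move=> t1 ninner.
have [[v tv]|nb] := pselect (exists v, t = arrive v); first by exists (inl v).
have unc v : ~ depart v < t <= arrive v.
  move=> /andP[at_]; rewrite le_eqVlt => /orP[/eqP tb|tb]; first by apply: nb; exists v.
  by apply: ninner; exists v; rewrite at_.
have /choice[c cP] : forall n, exists v, during n v t by move=> n; apply: during_ex.
have cle n m : (n <= m)%N -> cell n (c n) (c m).
  by move=> nm; apply: during_cell (cP n) (during_le nm (cP m)).
have nr n m : (n <= m)%N -> ~ removed n (c m).
  move=> nm rv; apply: (unc (c m)); rewrite -(during_removed _ rv).
  exact: during_le nm (cP m).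
have step n : entrance n (c n) <> c n.+1.
  rewrite -(entranceE (cle _ _ (leqnSn n))); exact: (nr n.+1).
have cE n : cell n (c n.+1) = cell n (c n) by apply/cellE/cle.
have CS n : cell n.+1 (c n.+1) `<=` cell n (c n).
  by rewrite -(cE n); apply: cellS_sub (cells_invP n) _.
have nS n : entrance n (c n.+1) <> c n.+1 by apply: (nr n.+1).
have eE n : entrance n (c n.+1) = entrance n (c n) by apply/entranceE/cle.
have rE n : rest n (c n.+1) = rest n (c n) by apply/restE/cle.
have [||n|r [rr rC]] := @ray_through D tournament_D (fun n => cell n (c n))
    (fun n => entrance n (c n)) CS.
- by move=> n; apply: cell_entrance.
- move=> n; rewrite cell_step // rE => /scomp_sub[_]; exact.
- have vv := rest_self (nS n).
  have := entranceS_mem (cells_invP n) (nS n).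
  have := entranceS_edge (cells_invP n) (nS n).
  have := @rest_fin n (c n.+1).
  rewrite eE rE in vv * => fin e0 em.
  have [rk0|rk] := pselect (crank (rest n (c n)) (c n.+1) = 0%N).
    by left; apply: e0.
  right; have m0 : (0 < ncomp (rest n (c n)))%N.
    by apply: ncomp_gt0; exact: vv.
  have [u ru rku] := ncomp_exists m0.
  have nu : entrance n u <> u.
    by rewrite (entranceE ru.1) => eu; case: ru => _; apply.
  have erk : crank (rest n u) u = 0%N by rewrite (restE ru.1).
  have ee := entranceS_edge (cells_invP n) nu erk.
  have me := entranceS_mem (cells_invP n) nu.
  rewrite (entranceE ru.1) (restE ru.1) in ee me.
  exists (entrance n.+1 u); split=> //.
  + by have [] := scomp_sub me.
  + rewrite cell_step // rE => vu'.
    have := crank_scomp vu'; rewrite (crank_scomp me) rku => /esym; exact: rk.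
  + apply: (crank_dominates tournament_D fin ru vv) me em.
    by rewrite rku lt0n; apply/eqP.
have rs : solid_ray r.
  split=> // X /finite_removed[n Xn].
  have Cc := cell_strong_component (ltn0Sn n) (nr n.+1 n.+1 (leqnn _)).
  have [Cs Cst _] := Cc.
  have CX : cell n.+1 (c n.+1) `<=` ~` X.
    by apply: subset_trans Cs _; apply: subsetC; apply: subset_trans Xn (@removedS _).
  exists (scomp (~` X) (c n.+1)).
    by apply: strong_component_scomp; apply: CX; apply: cell_self.
  have [k kC] := rC n.+1; exists k => m /kC.
  by apply: strong_sub_scomp => //; apply: cell_self.
have [w wr] := solid_ray_end rs.
exists (inr w) => n v nv; have [k kC] := rC n.
exists (fun i => r (i + k)%N); first exact: end_rays_shift.
move=> i; rewrite -(cellE (during_cell nv (cP n))).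
by apply: kC; apply: leq_addl.
Qed.

Lemma depart_not_inside v : v <> r0 ->
  -1 < depart v <= 1 /\ ~ (exists u, depart u < depart v < arrive u).
Proof.
move=> vr; have := depart_ge0 vr; have := depart_lt_arrive v; have := arrive_le1 v.
move=> b1 ab a0; split; first by apply/andP; split; lra.
move=> [u /andP[ua ub]]; have uv : u = v by apply: positions_overlap => //; lra.
by rewrite uv ltxx in ua.
Qed.

Lemma arrive_not_inside v :
  -1 < arrive v <= 1 /\ ~ (exists u, depart u < arrive v < arrive u).
Proof.
have := arrive_le1 v; have := depart_lt_arrive v; have := lo_le_depart 0 v => l0 ab b1; split.
  by apply/andP; split=> //; apply: le_lt_trans l0 ab.
move=> [u /andP[ub bu]]; have uv : u = v.
  by apply: positions_overlap => //; lra.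
by rewrite uv ltxx in bu.
Qed.

(** If an end is reached at time [depart v], then the intervals of its cells
    finish there, so that all their vertices have an edge to [v]. *)
Lemma arrow_into v (x : node D) : v <> r0 -> node_at (depart v) x ->
  is_edge x (inl v) \/ limit_edge x (inl v).
Proof.
move=> vr; have [/andP[a1 a1'] _] := depart_not_inside vr; case: x => [u avu|w tw].
  left=> /=; set n := maxn (depth u) (depth v).
  have ru : removed n u by apply/removed_depth/leq_maxl.
  have rv : removed n v by apply/removed_depth/leq_maxr.
  rewrite -(removed_entrance rv); apply: (@consecutive_edge n u); last exact: cell_self.
  by rewrite lo_removed // hi_removed.
right=> X fX nXv.
have [_ /(_ _)tailX] := end_compP w fX.
have rv := depthP v; set n := depth v in rv.
have [u nu] : exists u, during n u (depart v) by apply: during_ex; rewrite a1.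
have [s ws su] := tw _ _ nu.
have [k kC] := tailX _ ws.
exists (s k), v; split=> //; first exact: kC.
have := @consecutive_edge n u v (s k); rewrite (removed_entrance rv); apply=> //.
rewrite (lo_removed rv); move/andP: nu => [lu hu].
have nvu : ~ cell n v u by move=> /lo_same; rewrite (lo_removed rv) => E; rewrite E ltxx in lu.
have := lo_lt_hi n v.
by have [] := interval_disjoint nvu; rewrite (lo_removed rv); lra.
Qed.

(** * The path *)

Section Path.
Variables (node_of : R -> node D) (arrow_to : D -> arrow D).
Hypothesis node_ofP : forall t,
  -1 < t <= 1 -> ~ (exists v, depart v < t < arrive v) ->
  node_at t (node_of t).
Hypothesis arrow_toP : forall v, v <> r0 ->
  src (arrow_to v) = node_of (depart v) /\ tgt (arrow_to v) = inl v.

Definition hpath t : dspace R D :=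
  if pselect (exists v, depart v < t < arrive v) is left H then
    let v := sval (cid H) in
    arrow_point (arrow_to v) ((t - depart v) / (arrive v - depart v))
  else Node (node_of t).

Lemma hpath_node t : ~ (exists v, depart v < t < arrive v) -> hpath t = Node (node_of t).
Proof. by rewrite /hpath; case: pselect. Qed.

Lemma ratio_inside v t : depart v < t < arrive v ->
  0 < (t - depart v) / (arrive v - depart v) < 1.
Proof.
move=> /andP[at_ tb]; have ab := depart_lt_arrive v.
by rewrite divr_gt0 ?subr_gt0 // ltr_pdivrMr ?subr_gt0 // mul1r ltrD2r.
Qed.

Lemma hpath_inside v t : depart v < t < arrive v ->
  hpath t = arrow_point (arrow_to v) ((t - depart v) / (arrive v - depart v)).
Proof.
move=> vt; rewrite /hpath; case: pselect => [H|]; last by case; exists v.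
case: (cid H) => u /= ut; suff -> : u = v by [].
by apply: positions_overlap; lra.
Qed.

Lemma hpath_inner v t : depart v < t < arrive v ->
  exists2 u : {x : R | 0 < x < 1}, hpath t = Inner (arrow_to v) u &
    val u = (t - depart v) / (arrive v - depart v).
Proof.
move=> vt; exists (exist (fun x : R => 0 < x < 1) _ (ratio_inside vt)) => //.
by rewrite (hpath_inside vt) -arrow_point_inner.
Qed.

Lemma node_of_arrive v : node_of (arrive v) = inl v.
Proof.
have [b1 nin] := arrive_not_inside v; have := node_ofP b1 nin.
case: (node_of (arrive v)) => [u /arrive_inj -> //|w tw].
by case: (@node_at_end_uncovered _ _ v tw); rewrite depart_lt_arrive lexx.
Qed.

Lemma hpath_depart v : v <> r0 -> hpath (depart v) = Node (node_of (depart v)).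
Proof. by move=> /depart_not_inside[_ /hpath_node]. Qed.

Lemma hpath_arrive v : hpath (arrive v) = Node (inl v).
Proof. by have [_ /hpath_node ->] := arrive_not_inside v; rewrite node_of_arrive. Qed.

Lemma hpath_arrow v t : v <> r0 -> depart v <= t <= arrive v ->
  hpath t = arrow_point (arrow_to v) ((t - depart v) / (arrive v - depart v)).
Proof.
move=> vr /andP[]; have [sv tv] := arrow_toP vr; have ab := depart_lt_arrive v.
rewrite le_eqVlt => /orP[/eqP <- _|at_].
  by rewrite subrr mul0r arrow_point0 hpath_depart // sv.
rewrite le_eqVlt => /orP[/eqP ->|tb]; last by rewrite (@hpath_inside v) ?at_.
by rewrite divff ?arrow_point1 ?hpath_arrive ?tv // subr_eq0 gt_eqF.
Qed.

(** At a late step the two times lie in different cells, which are different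
    strong components of the same digraph [D - X]. *)
Lemma end_time_unique w s t : -1 < s <= 1 -> -1 < t <= 1 ->
  node_at s (inr w) -> node_at t (inr w) -> ~ s < t.
Proof.
move=> s1 t1 sw tw st; have [n nP] : exists n, forall v, ~ removed n v -> hi n v - lo n v < t - s.
  by apply: shrink; rewrite subr_gt0.
have nr m v r : node_at r (inr w) -> during m v r -> ~ removed m v.
  by move=> rw vr rv; apply: (node_at_end_uncovered (v := v) rw); rewrite -(during_removed _ rv).
have [v vt] := during_ex n.+1 t1; have [u us] := during_ex n.+1 s1.
have [r wr rv] := tw _ _ vt; have [q wq qu] := sw _ _ us.
have [Kc Kt] := end_compP w (removed_fin n.+1).
have cell_end (u0 : D) z p : during n.+1 u0 z -> node_at z (inr w) ->
    end_rays w p -> (forall k, cell n.+1 u0 (p k)) ->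
    cell n.+1 u0 = end_comp (removed n.+1) w.
  move=> uz zw wp pu; have [k kK] := Kt _ wp.
  have Cc := cell_strong_component (ltn0Sn n) (nr _ _ _ zw uz).
  exact: strong_component_eq Cc Kc (pu k) (kK k (leqnn k)).
have vu : cell n.+1 v u.
  rewrite (cell_end _ _ _ vt tw wr rv) -(cell_end _ _ _ us sw wq qu).
  exact: cell_self.
have := us; rewrite (cell_during _ vu) => /(during_le (leqnSn n))/andP[ls _].
have vt' := during_le (leqnSn n) vt; have := nP v (nr _ _ _ tw vt').
by move/andP: vt' => [_ th]; lra.
Qed.

Lemma hpath_inj : set_inj `[0, 1] hpath.
Proof.
move=> s t; rewrite !inE /= !in_itv /= => s01 t01 st.
have wide (x : R) : 0 <= x <= 1 -> -1 < x <= 1 by move=> /andP[? ?]; apply/andP; split=> //; lra.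
have [[u us]|ns] := pselect (exists u, depart u < s < arrive u);
    have [[v vt]|nt] := pselect (exists v, depart v < t < arrive v).
- have [y sE yE] := hpath_inner us; have [z tE zE] := hpath_inner vt.
  move: st; rewrite sE tE => -[euv yz].
  have s0 : 0 <= s by case/andP: s01.
  have t0 : 0 <= t by case/andP: t01.
  have uv : u = v.
    have [_ tu] := arrow_toP (inside_neq_r0 s0 us).
    have [_ tv] := arrow_toP (inside_neq_r0 t0 vt).
    by move: tu; rewrite euv tv => -[].
  have : (s - depart v) / (arrive v - depart v) = (t - depart v) / (arrive v - depart v).
    by rewrite -zE -yz yE uv.
  have ab := depart_lt_arrive v.
  by move=> /mulIf; rewrite invr_eq0 subr_eq0 gt_eqF // => /(_ isT)/addIr.
- by move: st; have [y -> _] := hpath_inner us; rewrite hpath_node.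
- by move: st; have [y -> _] := hpath_inner vt; rewrite hpath_node.
- move: st; rewrite !hpath_node // => -[node_ofE].
  have := node_ofP (wide _ s01) ns; have := node_ofP (wide _ t01) nt; rewrite node_ofE.
  case: (node_of t) => [u -> -> //|w tw sw].
  case: (ltgtP s t) => // [st|ts].
    by case: (end_time_unique (wide _ s01) (wide _ t01) sw tw st).
  by case: (end_time_unique (wide _ t01) (wide _ s01) tw sw ts).
Qed.

(** On the closed interval of [v] the path is an affine map followed by
    [arrow_point]. *)
Lemma hpath_continuous_arrow v U t : v <> r0 -> depart v <= t <= arrive v ->
  basic_open U -> U (hpath t) -> exists2 d : R, 0 < d &
    forall s, depart v <= s <= arrive v -> `|s - t| < d -> U (hpath s).
Proof.
move=> vr vt oU; have ab := depart_lt_arrive v; have ab0 : 0 < arrive v - depart v by rewrite subr_gt0.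
have ratio s : depart v <= s <= arrive v -> 0 <= (s - depart v) / (arrive v - depart v) <= 1.
  move=> /andP[as_ sb]; rewrite divr_ge0 ?subr_ge0 // ?(ltW ab) //=.
  by rewrite ler_pdivrMr // mul1r lerD2r.
rewrite (hpath_arrow vr vt) => /(arrow_point_continuous oU (ratio _ vt))[d d0 dP].
exists (d * (arrive v - depart v)); first exact: mulr_gt0.
move=> s vs st; rewrite (hpath_arrow vr vs); apply: dP; first exact: ratio.
rewrite -mulrBl opprB addrA subrK normrM (gtr0_norm (x := _^-1)) ?invr_gt0 //.
by rewrite ltr_pdivrMr.
Qed.

(** Every interval that finishes before time [1] is followed by that of a vertex,
    also when it belongs to the cells of an end. *)
Lemma hpath_right n v U : 0 <= hi n v -> basic_open U -> U (hpath (hi n v)) ->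
  exists2 d : R, 0 < d &
    forall s, hi n v <= s < hi n v + d -> s <= 1 -> U (hpath s).
Proof.
move=> h0 oU Uh; have h1 : hi n v <= 1 by apply: (hi_le v (leq0n n)).
have [h1'|h1'] := leP 1 (hi n v).
  exists 1 => // s /andP[hs _] s1; suff -> : s = hi n v by [].
  by apply/le_anti; rewrite hs (le_trans s1).
have [u au] := next_vertex h1'.
have ur : u <> r0 by move=> ur; rewrite ur depart_r0 in au; lra.
have ab := depart_lt_arrive u.
have [|d d0 dP] := @hpath_continuous_arrow u U (hi n v) ur _ oU Uh.
  by rewrite -au lexx ltW.
exists (Num.min d (arrive u - depart u)); first by rewrite lt_min d0 subr_gt0.
move=> s /andP[hs]; rewrite -ltrBlDl lt_min => /andP[sd sb] _.
apply: dP; first by apply/andP; split; lra.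
by rewrite ger0_norm // subr_ge0.
Qed.

(** The arrow into the entrance of [cell n v] is the only one into this cell that
    may start outside; it is over once the path is in the interval of
    [cell n.+1 v]. *)
Lemma hpath_end_nbhd n v s X w eps : entrance n v <> v -> during n.+1 v s ->
  cell n v `<=` end_comp X w -> end_nbhd X w eps (hpath s).
Proof.
move=> nv vs sub; have vs' := during_le (leqnSn n) vs.
have inN z : node_in n v z -> end_nodes X w z.
  case: z => [u nu|h [r hr rn]]; first by left; exists u => //; apply: sub.
  by right; exists h => //; exists r => // k; apply: sub.
have [ls hs] := andP vs'.
have l1 : -1 <= lo n v := lo_le v (leq0n n).
have h1 : hi n v <= 1 := hi_le v (leq0n n).
have lm : lo n v < lo n.+1 v.
  exact: lt_le_trans (lo_lt_mid n v) (mid_le_lo nv).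
have [[u us]|nin] := pselect (exists u, depart u < s < arrive u); last first.
  rewrite hpath_node //=; apply: inN; apply: node_at_in vs'; apply: node_ofP nin.
  by apply/andP; split; lra.
have [y -> _] := hpath_inner us.
have /andP[as_ sb] := us.
have vu : cell n.+1 v u.
  by apply: during_cell vs _; apply: during_vertex; rewrite as_ ltW.
have au : lo n v < depart u by apply: lt_le_trans lm _; rewrite -(lo_same vu) lo_le_depart.
have ur : u <> r0 by move=> ur; move: au; rewrite ur depart_r0 ltNge l1.
have [sE tE] := arrow_toP ur; constructor 1; rewrite sE tE; split; apply: inN.
  have [a1 na] := depart_not_inside ur.
  by apply: node_at_in (node_ofP a1 na) _; apply/andP; split=> //; lra.
exact: (cellS_sub (cells_invP n)) vu.
Qed.

Lemma hpath_continuous_end w U t : 0 <= t <= 1 -> node_at t (inr w) ->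
  hpath t = Node (inr w) -> basic_open U -> U (hpath t) -> exists2 d : R, 0 < d &
    forall s, 0 <= s <= 1 -> `|s - t| < d -> U (hpath s).
Proof.
move=> /andP[t0 t1] tw tE oU Ut.
have t1' : -1 < t <= 1 by apply/andP; split=> //; lra.
have [X [h [eps [fX wh UE]]]] : exists X h eps,
    [/\ finite_set X, end_nodes X h (inr w) & U = end_nbhd X h eps].
  by move: Ut; rewrite tE => /(basic_open_end oU).
have [q wq qh] : exists2 q, end_rays w q & forall k, end_comp X h (q k).
  by case: wh => [[]//|[w1 [q wq qh] [<-]]]; exists q.
have [n0 Xn] := finite_removed fX; pose n := n0.+1.
have [v vt] := during_ex n.+1 t1'.
have vt' := during_le (leqnSn n) vt.
have nr m : during m v t -> ~ removed m v.
  by move=> mt rv; apply: (node_at_end_uncovered tw (v := v)); rewrite -(during_removed _ rv).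
have nv : entrance n v <> v by apply: (nr n.+1).
have sub : cell n v `<=` end_comp X h.
  have [wc wt] := end_compP w fX; have [hc _] := end_compP h fX.
  have [r wr rv] := tw _ _ vt'.
  have [k kP] := wt _ wr; have [l lP] := wt _ wq.
  rewrite -(strong_component_eq wc hc (lP l (leqnn l)) (qh l)).
  have [Cs Cst _] := cell_strong_component (ltn0Sn n0) (nr _ vt').
  apply: (strong_component_absorb wc _ Cst (rv k) (kP k (leqnn k))).
  apply: subset_trans Cs _; apply: subsetC.
  exact: subset_trans Xn (@removedS _).
have inU s : during n.+1 v s -> U (hpath s).
  by rewrite UE => vs; apply: hpath_end_nbhd vs sub.
have /andP[lt th] := vt.
have [d d0 dP] : exists2 d : R, 0 < d & forall s, t < s < t + d -> s <= 1 -> U (hpath s).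
  have [th'|ht] := ltP t (hi n.+1 v).
    exists (hi n.+1 v - t); first by rewrite subr_gt0.
    by move=> s /andP[ts sh] _; apply: inU; apply/andP; split; lra.
  have hE : hi n.+1 v = t by apply/le_anti; rewrite ht th.
  have [||d d0 dP] := @hpath_right n.+1 v U _ oU; rewrite ?hE //.
  by exists d => // s /andP[ts sd]; apply: dP; rewrite hE ltW.
exists (Num.min d (t - lo n.+1 v)); first by rewrite lt_min d0 subr_gt0.
move=> s /andP[s0 s1]; rewrite lt_min !ltr_norml => /andP[/andP[_ sd] /andP[sl _]].
have [st|ts] := leP s t; last by apply: dP => //; apply/andP; split; lra.
by apply: inU; apply/andP; split; lra.
Qed.

Lemma hpath_continuous_at U t : 0 <= t <= 1 -> basic_open U -> U (hpath t) ->
  exists2 d : R, 0 < d & forall s, 0 <= s <= 1 -> `|s - t| < d -> U (hpath s).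
Proof.
move=> t01 oU Ut; have /andP[t0 t1] := t01.
have [[v vt]|nin] := pselect (exists v, depart v < t < arrive v).
  have vr := inside_neq_r0 t0 vt; have /andP[at_ tb] := vt.
  have [|d d0 dP] := hpath_continuous_arrow vr _ oU Ut; first by rewrite !ltW.
  exists (Num.min d (Num.min (t - depart v) (arrive v - t))).
    by rewrite !lt_min d0 !subr_gt0 at_.
  move=> s _; rewrite !lt_min => /and3P[sd]; rewrite !ltr_norml => /andP[? ?] /andP[? ?].
  by apply: dP => //; apply/andP; split; lra.
have tnd : node_at t (node_of t) by apply: node_ofP nin; apply/andP; split=> //; lra.
have := hpath_node nin; case: (node_of t) tnd => [v tb|w tw] tE; last first.
  exact: hpath_continuous_end tw tE oU Ut.
have tb' : t = arrive v := tb.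
have hE := hi_removed (depthP v).
have [||d d0 dP] := @hpath_right (depth v) v U _ oU; rewrite ?hE -?tb' //.
have [c c0 cP] : exists2 c : R, 0 < c & forall s, 0 <= s <= t -> t - c < s -> U (hpath s).
  have [vr|vr] := pselect (v = r0).
    exists 1 => // s /andP[s0 st] _; suff -> : s = t by [].
    by move: tb'; rewrite vr arrive_r0; lra.
  have ab := depart_lt_arrive v.
  have [|c c0 cP] := @hpath_continuous_arrow v U t vr _ oU Ut.
    by rewrite tb' lexx ltW.
  exists (Num.min c (arrive v - depart v)); first by rewrite lt_min c0 subr_gt0.
  move=> s /andP[s0 st] cs.
  have : t - s < Num.min c (arrive v - depart v) by lra.
  rewrite lt_min => /andP[sc sb]; apply: cP; first by apply/andP; split; lra.
  by rewrite distrC ger0_norm // subr_ge0.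
exists (Num.min c d); first by rewrite lt_min c0.
move=> s /andP[s0 s1]; rewrite lt_min !ltr_norml => /andP[/andP[sc _] /andP[_ sd]].
have [st|ts] := leP s t; first by apply: cP; [rewrite s0|lra].
by apply: dP => //; rewrite hE -tb' ltW //=; lra.
Qed.

Lemma hpath_continuous : {within `[0, 1], continuous hpath}.
Proof.
apply/subspace_continuousP => t; rewrite /= in_itv /= => t01.
apply: dspace_cvg => U oU Ut.
have [d d0 dP] := hpath_continuous_at t01 oU Ut.
rewrite /within /=; apply/nbhs_ballP; exists d => // s.
rewrite /ball /= distrC in_itv /= => st s01; exact: dP.
Qed.

(** A short cell around the midpoint starts with the interval of its
    entrance. *)
Lemma arrows_dense s t : 0 <= s -> s < t -> t <= 1 ->
  exists v x, [/\ s < x, x < t & depart v < x < arrive v].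
Proof.
move=> s0 st t1; pose m := (s + t) / 2.
have sm : s < m by rewrite /m; lra.
have mt : m < t by rewrite /m; lra.
suff [v sa ab] : exists2 v, depart v < m & s < arrive v.
  exists v, ((Num.max s (depart v) + Num.min m (arrive v)) / 2).
  have := depart_lt_arrive v; rewrite /Num.max /Num.min.
  case: (ltP s (depart v)) => ?; case: (ltP m (arrive v)) => ? ?;
    by split; try apply/andP; try split; lra.
have m1 : -1 < m <= 1 by apply/andP; split; lra.
have [n nP] : exists n, forall v, ~ removed n v -> hi n v - lo n v < m - s.
  by apply: shrink; rewrite subr_gt0.
have [v vm] := during_ex n m1; have /andP[lm mh] := vm.
have [rv|/nP nv] := pselect (removed n v).
  exists v; first by rewrite -(lo_removed rv).
  by rewrite -(hi_removed rv); lra.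
have ve := @cell_entrance n v.
exists (entrance n v); first by rewrite -(@lo_entrance n) ?(lo_same ve) //; apply: entranceE.
apply: lt_trans (depart_lt_arrive _); rewrite -(@lo_entrance n) ?(lo_same ve); last exact: entranceE.
lra.
Qed.

(** Between [s] and [t] the path meets an inner point of some arrow that it
    traverses; this must be [e], and by injectivity the path is on [[0,1]_e] only
    while it traverses [e]. *)
Lemma hpath_directed s t (e : arrow D) : 0 <= s -> s < t -> t <= 1 ->
  hpath @` `[s, t] `<=` arrow_itv e ->
  forall x y : R, 0 <= x <= 1 -> 0 <= y <= 1 ->
    hpath s = arrow_point e x -> hpath t = arrow_point e y -> x <= y.
Proof.
move=> s0 st t1 ste x y x01 y01 sx ty.
have [v [m [sm mt vm]]] := arrows_dense s0 st t1.
have m0 : 0 <= m by apply: le_trans s0 (ltW sm).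
have vr := inside_neq_r0 m0 vm.
have ab := depart_lt_arrive v; have a0 := depart_ge0 vr; have b1 := arrive_le1 v.
have ev : e = arrow_to v.
  have : arrow_itv e (hpath m).
    by apply: ste; exists m => //; rewrite /= in_itv /= !ltW.
  have [u -> _] := hpath_inner vm; move=> [z]; rewrite /= in_itv /= => z01.
  case: (unit_pointP z01) => [->|->|z' ->].
  - by rewrite arrow_point0.
  - by rewrite arrow_point1.
  - by rewrite arrow_point_inner => -[].
have par z r : 0 <= z <= 1 -> 0 <= r <= 1 -> hpath r = arrow_point e z ->
    r = depart v + z * (arrive v - depart v).
  move=> /andP[z0 z1] r01 rz.
  have zle : 0 <= z * (arrive v - depart v) <= arrive v - depart v.
    by rewrite mulr_ge0 ?subr_ge0 ?(ltW ab) //= ler_piMl // subr_ge0 ltW.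
  apply: hpath_inj; rewrite ?inE /= ?in_itv //=; first by apply/andP; split; lra.
  rewrite rz ev (@hpath_arrow v) //; last by apply/andP; split; lra.
  by rewrite addrAC subrr add0r mulfK // subr_eq0 gt_eqF.
have := par _ _ x01 _ sx; have := par _ _ y01 _ ty.
rewrite s0 t1 (le_trans s0 (ltW st)) (le_trans (ltW st) t1) => /(_ isT) tE /(_ isT) sE.
by move: st; rewrite sE tE ltrD2l ltr_pM2r ?subr_gt0 // => /ltW.
Qed.

Lemma hpath_hamilton : hamilton_path hpath /\ hpath 0 = Node (inl r0).
Proof.
split; last by rewrite -arrive_r0 hpath_arrive.
split; [split; [exact: hpath_continuous|exact: hpath_directed]|exact: hpath_inj|].
move=> v; exists (arrive v); last exact: hpath_arrive.
rewrite arrive_le1 andbT; have [->|/depart_ge0 a0] := pselect (v = r0); first by rewrite arrive_r0.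
exact: le_trans a0 (ltW (depart_lt_arrive v)).
Qed.

End Path.

Lemma hamilton_path_from_r0 : exists f : R -> dspace R D,
  hamilton_path f /\ f 0 = Node (inl r0).
Proof.
have /choice[node_of node_ofP] : forall t : R, exists z : node D,
    -1 < t <= 1 -> ~ (exists v, depart v < t < arrive v) -> node_at t z.
  move=> t; have [[t1 nin]|no] := pselect (-1 < t <= 1 /\ ~ (exists v, depart v < t < arrive v)).
    by have [z zP] := node_at_ex t1 nin; exists z.
  by exists (inl r0) => t1 nin; case: no.
have arrow_ex v : v <> r0 -> exists e : arrow D, src e = node_of (depart v) /\ tgt e = inl v.
  move=> vr; have [a1 nin] := depart_not_inside vr.
  by exists (Arrow (arrow_into vr (node_ofP _ a1 nin))).
have [v1 v1r] := nontrivial; have [e1 _] := arrow_ex _ v1r.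
have /choice[arrow_to arrow_toP] : forall v, exists e : arrow D,
    v <> r0 -> src e = node_of (depart v) /\ tgt e = inl v.
  move=> v; have [vr|/arrow_ex[e eP]] := pselect (v = r0); last by exists e.
  by exists e1.
by exists (hpath node_of arrow_to); apply: hpath_hamilton.
Qed.

End Cells.

(** * Existence of a root *)

(** The first component dominates all others. *)
Lemma exists_root (D : digraph) (r : D) : tournament D -> solid D ->
  exists r', forall v : D, reach r' v.
Proof.
move=> tD sD.
have fin : finite_set (strong_component (~` [set: D])) by rewrite setCT; apply: sD.
have c0 : (0 < ncomp [set: D])%N.
  exact: leq_ltn_trans (crank_lt tD fin (I : [set: D] r)).
have [r' _ r'0] := crank_surj tD fin c0.
exists r' => v; have [rk|rk] := eqVneq (crank [set: D] v) 0%N.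
  have : scomp [set: D] r' v.
    rewrite -(@crank_inj _ tD _ fin v r') ?r'0 //; exact: scomp_refl.
  by case.
apply: reach_in_edge => //; apply: (@crank_dominates _ tD _ fin r' v) => //.
- by rewrite r'0 lt0n.
- exact: scomp_refl.
- exact: scomp_refl.
Qed.

Theorem theorem1 (R : realType) (D : digraph)
  (countably_infinite : ([set: vertex D] #= [set: nat])%card)
  (solid_D : solid D) (tournament_D : tournament D) :
  (exists f : R -> dspace R D, hamilton_path f) /\
  (forall r : vertex D, (forall v : vertex D, v <> r -> reach r v) ->
     exists f : R -> dspace R D, hamilton_path f /\ f 0 = Node (inl r)).
Proof.
have /card_set_bijP[idx [_ idx_inj idx_surj]] := countably_infinite.
have idxI : injective idx by move=> u v; apply: idx_inj; rewrite inE.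
have rooted (r : D) : (forall v : D, v <> r -> reach r v) ->
    exists f : R -> dspace R D, hamilton_path f /\ f 0 = Node (inl r).
  move=> rP; apply: (hamilton_path_from_r0 tournament_D solid_D idxI rP).
  have [u _ u0] := idx_surj 0%N I; have [v _ v1] := idx_surj 1%N I.
  have [ur|] := pselect (u = r); last by exists u.
  by exists v => vr; move: v1; rewrite vr -ur u0.
split=> //; have [u _ _] := idx_surj 0%N I.
have [r rP] := exists_root u tournament_D solid_D.
by have [f [fP _]] := rooted r (fun v _ => rP v); exists f.
Qed.
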